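(* Let $\mathfrak{U}$ be a family of finite-dimensional unitary groups equipped with bi-invariant submultiplicative norms. Then Thompson's groups $F$, $F'$, $T$ and $V$ are not uniformly $\mathfrak{U}$-approximable. The same holds for $\Gamma\wr\Lambda$, whenever $\Gamma,\Lambda$ are countable groups, $\Lambda$ is infinite and amenable, and $\Gamma$ is non-abelian.
   Context: All groups are discrete and countable. $\mathfrak{U}$ is a family of pairs $(U(k),\|\cdot\|)$, where $U(k)$ is the group of $k\times k$ unitary matrices and $\|\cdot\|$ is a norm on $k\times k$ complex matrices that is submultiplicative ($\|AB\|\le\|A\|\|B\|$) and bi-invariant ($\|uAv\|=\|A\|$ for $u,v\in U(k)$); the same $U(k)$ may occur several times with different norms. A *uniform asymptotic homomorphism* $\phi:G\to\mathfrak{U}$ is a sequence of maps $\phi_n:G\to U(k_n)$, with $(U(k_n),\|\cdot\|)\in\mathfrak{U}$, such that $\sup_{g,h\in G}\|\phi_n(gh)-\phi_n(g)\phi_n(h)\|\to0$. A group $G$ is *uniformly $\mathfrak{U}$-approximable* if there is a uniform asymptotic homomorphism $(\phi_n)$ to $\mathfrak{U}$ that is *asymptotically injective*: for all $g\in G$, $g\ne1$, one has $\liminf_{n\to\infty}\|\phi_n(g)-I_{k_n}\|>0$. $\Gamma\wr\Lambda=(\bigoplus_\Lambda\Gamma)\rtimes\Lambda$ is the restricted wreath product, $\Lambda$ acting by shifting coordinates. $F$ is the group of orientation-preserving piecewise linear homeomorphisms of $[0,1]$ with breakpoints in $\mathbb{Z}[1/2]$ and slopes in $2^{\mathbb{Z}}$;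 $F'$ is its derived (commutator) subgroup. $T$ is the group of orientation-preserving piecewise linear homeomorphisms of the circle $\mathbb{R}/\mathbb{Z}$ preserving $\mathbb{Z}[1/2]/\mathbb{Z}$, with breakpoints in $\mathbb{Z}[1/2]/\mathbb{Z}$ and slopes in $2^{\mathbb{Z}}$. $V$ is the following group of homeomorphisms of the Cantor set $X=2^{\mathbb{N}}$: a *dyadic brick* is a clopen set $X_\sigma$ of all infinite binary sequences with a given finite prefix $\sigma$; any two dyadic bricks are canonically homeomorphic via $X_\sigma\to X_\tau:\sigma x\mapsto\tau x$; an element of $V$ is a homeomorphism given by two finite partitions of $X$ of the same size into dyadic bricks, the bricks of the first being sent to those of the second (by some bijection) via the canonical homeomorphisms. *)

(* Defs.v *)
From HB Require Import structures.
From mathcomp Require Import all_boot all_order all_algebra finmap.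
From mathcomp Require Import complex.
From mathcomp Require Import all_classical all_reals all_analysis.

Set Implicit Arguments.
Unset Strict Implicit.
Unset Printing Implicit Defensive.

Import Order.TTheory GRing.Theory Num.Theory.
Import numFieldNormedType.Exports.

Local Open Scope classical_set_scope.
Local Open Scope ring_scope.
Local Open Scope quotient_scope.

(* The norm is defined on all k x k complex matrices; elements of U(k) are the
   matrices satisfying [unitarymx]. *)
Record normed_unitary (R : realType) := NormedUnitary {
  udim : nat;
  unorm : 'M[R[i]]_udim -> R;
  unormD : forall A B, unorm (A + B) <= unorm A + unorm B;
  unormZ : forall (c : R[i]) A, unorm (c *: A) = Normc.normc c * unorm A;
  unorm_eq0 : forall A, unorm A = 0 -> A = 0;
  unormM : forall A B, unorm (A *m B) <= unorm A * unorm B;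
  unorm_biinv : forall u A v, u \is unitarymx -> v \is unitarymx ->
    unorm (u *m A *m v) = unorm A }.

Section Approximability.
Context {R : realType}.
Implicit Types (U : set (normed_unitary R)) (G : groupType).

(* The supremum is taken in the extended reals, where unbounded sets have
   supremum +oo (the real-valued [sup] of an unbounded set is 0). *)
Definition uniform_asymptotic_hom U G (K : nat -> normed_unitary R)
    (phi : forall n, G -> 'M[R[i]]_(udim (K n))) : Prop :=
  [/\ forall n, U (K n),
      forall n g, phi n g \is unitarymx &
      ereal_sup [set (unorm (phi n (g * h)%g - phi n g *m phi n h))%:E
                | g in [set: G] & h in [set: G]] @[n --> \oo] --> 0%E].

Definition asymptotically_injective G (K : nat -> normed_unitary R)
    (phi : forall n, G -> 'M[R[i]]_(udim (K n))) : Prop :=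
  forall g : G, g <> 1%g ->
    (0 < limn_einf (fun n => (unorm (phi n g - 1%:M))%:E))%E.

Definition uniformly_approximable U G : Prop :=
  exists (K : nat -> normed_unitary R)
         (phi : forall n, G -> 'M[R[i]]_(udim (K n))),
    uniform_asymptotic_hom U phi /\ asymptotically_injective phi.

End Approximability.

(* [m] is only constrained on bounded functions: it is a left-invariant mean
   on l^oo(G), extended arbitrarily to all functions. *)
Definition left_invariant_mean (R : realType) (G : groupType)
    (m : (G -> R) -> R) : Prop :=
  [/\ forall f1 f2 : G -> R, bounded_fun f1 -> bounded_fun f2 ->
        m (f1 \+ f2) = m f1 + m f2,
      forall (c : R) (f : G -> R), bounded_fun f -> m (fun x => c * f x) = c * m f,
      forall f : G -> R, bounded_fun f -> (forall x, 0 <= f x) -> 0 <= m f,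
      m (fun=> 1) = 1 &
      forall (g : G) (f : G -> R), bounded_fun f -> m (fun x => f (g * x)%g) = m f].

Definition amenable (R : realType) (G : groupType) : Prop :=
  exists m : (G -> R) -> R, left_invariant_mean m.

Record subgroup (G : groupType) := Subgroup {
  subgroup_set :> set G;
  subgroup_closed : group_closed (mem subgroup_set) }.

Section SubgroupType.
Context (G : groupType) (H : subgroup G).

Definition subgroup_type : Type := {x : G | x \in subgroup_set H}.

HB.instance Definition _ := SubChoice.on subgroup_type.
HB.instance Definition _ := SubChoice_isSubGroup.Build G
  (fun x => x \in subgroup_set H) subgroup_type (subgroup_closed H).

End SubgroupType.

Definition subgroup_group (G : groupType) (H : subgroup G) : groupType :=
  subgroup_type H.

Coercion subgroup_group : subgroup >-> Group.type.

Definition derived_set (G : groupType) : set G :=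
  smallest [set A : set G | group_closed (mem A)]
    [set [~ x, y]%g | x in [set: G] & y in [set: G]].

Arguments derived_set : clear implicits.

Lemma derived_set_closed (G : groupType) : group_closed (mem (derived_set G)).
Proof.
split.
  by apply/mem_set => A [[A1 _] _]; apply/set_mem.
move=> x y /set_mem dx /set_mem dy; apply/mem_set => A [Agrp Acomm].
have [_ AF] := Agrp.
by apply/set_mem/AF; apply/mem_set; [apply: dx | apply: dy].
Qed.

Definition derived (G : groupType) : subgroup G :=
  Subgroup (@derived_set_closed G).

Record homeo (X : topologicalType) := Homeo {
  homeo_fun :> X -> X;
  homeo_inv : X -> X;
  homeoK : cancel homeo_fun homeo_inv;
  homeo_invK : cancel homeo_inv homeo_fun;
  homeo_continuous : continuous homeo_fun;
  homeo_inv_continuous : continuous homeo_inv }.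

Section HomeoGroup.
Context {X : topologicalType}.
Implicit Types f g h : homeo X.

HB.instance Definition _ := gen_eqMixin (homeo X).
HB.instance Definition _ := gen_choiceMixin (homeo X).

Lemma homeoP f g : f =1 g -> f = g.
Proof.
case: f g => [f f' fK f'K cf cf'] [g g' gK g'K cg cg'] /= fg.
have {}fg : f = g by apply/funext.
subst g; have f'g' : f' = g' by apply/funext => x; rewrite -{1}(g'K x) fK.
by subst g'; f_equal; exact: Prop_irrelevance.
Qed.

Definition homeo_one : homeo X :=
  @Homeo X id id (fun=> erefl) (fun=> erefl) (fun x => cvg_id)
    (fun x => cvg_id).

Definition homeo_opp f : homeo X :=
  Homeo (@homeo_invK X f) (@homeoK X f) (@homeo_inv_continuous X f)
    (@homeo_continuous X f).

Lemma homeo_comp_continuous (u v : X -> X) :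
  continuous u -> continuous v -> continuous (u \o v).
Proof. by move=> cu cv x; apply: continuous_comp; [exact: cv|exact: cu]. Qed.

Definition homeo_comp f g : homeo X :=
  Homeo (can_comp (@homeoK X f) (@homeoK X g))
    (can_comp (@homeo_invK X g) (@homeo_invK X f))
    (homeo_comp_continuous (@homeo_continuous X f) (@homeo_continuous X g))
    (homeo_comp_continuous (@homeo_inv_continuous X g)
       (@homeo_inv_continuous X f)).

Lemma homeo_compA : associative homeo_comp.
Proof. by move=> f g h; exact: homeoP. Qed.
Lemma homeo_comp1h : left_id homeo_one homeo_comp.
Proof. by move=> f; exact: homeoP. Qed.
Lemma homeo_comph1 : right_id homeo_one homeo_comp.
Proof. by move=> f; exact: homeoP. Qed.
Lemma homeo_compVh : left_inverse homeo_one homeo_opp homeo_comp.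
Proof. by move=> f; apply: homeoP => x /=; rewrite homeoK. Qed.
Lemma homeo_comphV : right_inverse homeo_one homeo_opp homeo_comp.
Proof. by move=> f; apply: homeoP => x /=; rewrite homeo_invK. Qed.

HB.instance Definition _ := isGroup.Build (homeo X) homeo_compA homeo_comp1h
  homeo_comph1 homeo_compVh homeo_comphV.

Lemma homeo1E x : (1%g : homeo X) x = x. Proof. by []. Qed.
Lemma homeoME f g x : (f * g)%g x = f (g x). Proof. by []. Qed.
Lemma homeoVE f : (f^-1)%g = homeo_inv f :> (X -> X). Proof. by []. Qed.

Lemma homeo_closed (A : set (homeo X)) : A 1%g ->
  (forall f g, A f -> A g -> A (f * g)%g) -> (forall f, A f -> A (f^-1)%g) ->
  group_closed (mem A).
Proof.
move=> A1 AM AV; split; first exact/mem_set.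
by move=> f g /set_mem Af /set_mem Ag; apply/mem_set/AM => //; exact: AV.
Qed.

End HomeoGroup.

Section DyadicPL.
Context {R : realType}.

Definition dyadic : set R :=
  [set x | exists (m : int) (n : nat), x = m%:~R / 2 ^+ n].

(* [X] is embedded in R by [v], and [P] contains all breakpoints of [h]: on
   every closed interval whose interior does not meet [P], [h] is affine with
   slope in 2^Z. *)
Definition affine_off (X : Type) (v : X -> R) (P : set X) (h : X -> X) : Prop :=
  forall a b : X, (forall x, v a < v x < v b -> ~ P x) ->
    exists (k : int) (c : R),
      forall x, v a <= v x <= v b -> v (h x) = 2 ^ k * v x + c.

Lemma dyadicD x y : dyadic x -> dyadic y -> dyadic (x + y).
Proof.
move=> [m [n ->]] [p [q ->]].
exists (m * 2 ^+ q + p * 2 ^+ n), (n + q)%N.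
rewrite rmorphD !rmorphM /= !rmorphXn /= exprD.
have h2 k : (2 ^+ k : R) != 0 by rewrite expf_neq0.
by rewrite addf_div// [2 ^+ n * _]mulrC.
Qed.

Lemma dyadicN x : dyadic x -> dyadic (- x).
Proof. by move=> [m [n ->]]; exists (- m), n; rewrite rmorphN mulNr. Qed.

Lemma dyadicB x y : dyadic x -> dyadic y -> dyadic (x - y).
Proof. by move=> dx dy; apply/dyadicD => //; exact: dyadicN. Qed.

Lemma dyadic_exp (k : int) x : dyadic x -> dyadic (2 ^ k * x).
Proof.
move=> [m [n ->]]; case: k => k.
  exists (2 ^+ k * m), n; rewrite rmorphM rmorphXn /= -exprnP.
  by rewrite mulrA.
exists m, (k.+1 + n)%N; rewrite NegzE -exprnN exprD invfM mulrCA.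
by rewrite mulrA.
Qed.

Lemma dyadic0 : dyadic 0.
Proof. by exists 0, 0%N; rewrite mul0r. Qed.

Lemma affine_offS (X : Type) (v : X -> R) (P Q : set X) (h : X -> X) :
  P `<=` Q -> affine_off v P h -> affine_off v Q h.
Proof. by move=> PQ hP a b ab; apply: hP => x /ab nQ /PQ. Qed.

Section IncreasingHomeo.
Context {X : topologicalType} (v : X -> R) (v_inj : injective v).
Implicit Types f g h : homeo X.

Let incr f := {homo f : x y / v x < v y}.

Lemma incr_mono f : incr f -> {mono f : x y / v x < v y}.
Proof.
move=> fi x y; apply/idP/idP => [|/fi//].
rewrite !ltNge; apply: contra.
by rewrite le_eqVlt => /orP[/eqP/v_inj->//|/fi/ltW].
Qed.

Lemma incr_mono_le f : incr f -> {mono f : x y / v x <= v y}.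
Proof. by move=> fi x y; rewrite !leNgt incr_mono. Qed.

Lemma incrM f g : incr f -> incr g -> incr (f * g)%g.
Proof. by move=> fi gi x y /gi/fi. Qed.

Lemma incrV f : incr f -> incr (f^-1)%g.
Proof.
by move=> fi x y xy; rewrite homeoVE -(incr_mono fi) !homeo_invK.
Qed.

Lemma affine_off1 (P : set X) : affine_off v P (1%g : homeo X).
Proof. by move=> a b _; exists 0, 0 => x _; rewrite expr0z mul1r addr0. Qed.

Lemma affine_offM f g (P Q : set X) : incr g ->
  affine_off v P f -> affine_off v Q g ->
  affine_off v (Q `|` g @^-1` P) (f * g)%g.
Proof.
move=> gi fP gQ a b ab.
have [k [c kc]] := gQ a b (fun x xab Qx => ab x xab (or_introl Qx)).
have [|l [d ld]] := fP (g a) (g b).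
  move=> y yab Py; apply: (ab (homeo_inv g y)); last first.
    by right; rewrite /= homeo_invK.
  by rewrite -(incr_mono gi a) -(incr_mono gi _ b) homeo_invK.
exists (l + k), (2 ^ l * c + d) => x xab.
rewrite homeoME ld ?(incr_mono_le gi)// kc// expfzDr//.
by rewrite mulrDr mulrA addrA.
Qed.

Lemma affine_offV f (P : set X) : incr f ->
  affine_off v P f -> affine_off v (homeo_inv f @^-1` P) (f^-1)%g.
Proof.
move=> fi fP a b ab.
have [|k [c kc]] := fP (homeo_inv f a) (homeo_inv f b).
  move=> x; rewrite -(incr_mono fi _ x) -(incr_mono fi x) !homeo_invK.
  move=> xab Px.
  by apply: (ab (f x)) => //=; rewrite homeoK.
exists (- k), (- (2 ^ (- k) * c)) => y yab; rewrite homeoVE.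
have := kc (homeo_inv f y).
rewrite -(incr_mono_le fi _ (homeo_inv f y)) -(incr_mono_le fi (homeo_inv f y)).
rewrite !homeo_invK => /(_ yab) ->.
rewrite mulrDr mulrA -expfzDr// addNr expr0z mul1r.
by rewrite addrK.
Qed.

End IncreasingHomeo.
End DyadicPL.

Section ThompsonF.
Context (R : realType).

Definition unit_interval : topologicalType := set_type `[0 : R, 1]%classic.

Definition ival (x : unit_interval) : R := set_val x.

Implicit Types (f : homeo unit_interval) (x : unit_interval).

Definition thompsonF_set : set (homeo unit_interval) :=
  [set f : homeo unit_interval | {homo f : x y / ival x < ival y} /\
     exists B : set R, [/\ finite_set B, B `<=` dyadic &
       affine_off ival (ival @^-1` B) f]].

Lemma ival_inj : injective ival.
Proof. exact: val_inj. Qed.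

Lemma unit_intervalP x : 0 <= ival x <= 1.
Proof. by have /set_mem := valP x; rewrite /= in_itv. Qed.

Lemma thompsonF_fix0 f x : thompsonF_set f -> ival x = 0 -> ival (f x) = 0.
Proof.
move=> [fi _] x0; apply/eqP; rewrite eq_le.
have /andP[-> _] := unit_intervalP (f x); rewrite andbT.
rewrite -[X in _ <= X]x0 -[X in _ <= ival X](homeo_invK f).
rewrite (incr_mono_le ival_inj fi) x0.
by have /andP[] := unit_intervalP (homeo_inv f x).
Qed.

Lemma count_lt (T : eqType) (p q : pred T) (s : seq T) (y : T) :
  y \in s -> q y -> ~~ p y -> subpred p q -> (count p s < count q s)%N.
Proof.
move=> ys qy py pq; have : (count (predU p (pred1 y)) s <= count q s)%N.
  by apply: sub_count => z /orP[/pq//|/eqP->].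
apply: leq_trans; have := count_predUI p (pred1 y) s.
rewrite (_ : count (predI p (pred1 y)) s = 0%N); last first.
  rewrite -(count_pred0 s); apply: eq_count => z /=.
  by apply/negbTE/negP => /andP[pz /eqP zy]; rewrite zy (negbTE py) in pz.
by rewrite addn0 => ->; rewrite -addn1 leq_add2l -has_count has_pred1.
Qed.

Lemma thompsonF_dyadic f x : thompsonF_set f ->
  dyadic (ival (f x)) <-> dyadic (ival x).
Proof.
move=> fF; have [_ [B [/finite_seqP[s Bs] Bdyadic fB]]] := fF.
pose between (a z : unit_interval) : pred R := fun b => ival a < b < ival z.
have affine (a z : unit_interval) : {in s, forall y, ~~ between a z y} -> ival a <= ival z ->
    dyadic (ival a) -> dyadic (ival (f a)) ->
    dyadic (ival (f z)) <-> dyadic (ival z).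
  move=> nos az da dfa; have [|k [c kc]] := fB a z.
    by move=> y ayz; rewrite /= Bs => /= /nos; rewrite /between ayz.
  have fz : ival (f z) = ival (f a) + 2 ^ k * (ival z - ival a).
    by rewrite !kc ?lexx ?az// mulrBr [RHS]addrC addrA subrK.
  split => d; last by rewrite fz; apply/dyadicD/dyadic_exp/dyadicB.
  have -> : ival z = ival a + 2 ^ (- k) * (ival (f z) - ival (f a)).
    rewrite fz [ival (f a) + _]addrC addrK mulrA -expfzDr// addNr expr0z.
    by rewrite mul1r addrC subrK.
  by apply/dyadicD/dyadic_exp/dyadicB.
have key n : forall a z : unit_interval, (count (between a z) s <= n)%N ->
    ival a <= ival z -> dyadic (ival a) -> dyadic (ival (f a)) ->
    dyadic (ival (f z)) <-> dyadic (ival z).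
  elim: n => [|n IHn] a z cnt az da dfa;
      have [/hasP[y ys yaz]|/hasPn nos] := boolP (has (between a z) s).
  - by move: cnt; rewrite leqNgt -has_count => /negP[]; apply/hasP; exists y.
  - exact: (affine a z nos az da dfa).
  - have yI : y \in `[0 : R, 1]%classic.
      rewrite inE /= in_itv /=; move/andP: yaz => [ay yz].
      have /andP[a0 _] := unit_intervalP a; have /andP[_ z1] := unit_intervalP z.
      by rewrite (ltW (le_lt_trans a0 ay)) (ltW (lt_le_trans yz z1)).
    pose w : unit_interval := exist _ y yI.
    have /andP[aw wz] : ival a < ival w < ival z by [].
    have dw : dyadic (ival w) by apply: Bdyadic; rewrite Bs.
    have caw : (count (between a w) s < count (between a z) s)%N.
      apply: (count_lt ys) => //; first by rewrite /between ltxx andbF.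
      by move=> b /andP[ab bw]; rewrite /between ab (lt_trans bw wz).
    have cwz : (count (between w z) s < count (between a z) s)%N.
      apply: (count_lt ys) => //; first by rewrite /between ltxx.
      by move=> b /andP[wb bz]; rewrite /between bz (lt_trans aw wb).
    have [_ dfw] := IHn a w (leq_trans caw cnt) (ltW aw) da dfa.
    exact: IHn w z (leq_trans cwz cnt) (ltW wz) dw (dfw dw).
  - exact: (affine a z nos az da dfa).
have o0 : 0 \in `[0 : R, 1]%classic by rewrite inE /= in_itv /= lexx ler01.
pose o : unit_interval := exist _ 0 o0.
have /andP[ox _] := unit_intervalP x.
apply: (key _ o x (leqnn _) ox); first exact: dyadic0.
by rewrite (thompsonF_fix0 fF)//; exact: dyadic0.
Qed.

Lemma thompsonF_closed : group_closed (mem thompsonF_set).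
Proof.
apply: homeo_closed => [|f g fF gF|f fF].
- split=> //; exists set0.
  split; [exact: finite_set0|exact: sub0set|exact: affine_off1].
- have [fi [B [Bfin Bd fB]]] := fF; have [gi [C [Cfin Cd gC]]] := gF.
  split; first exact: incrM.
  exists (C `|` [set ival (homeo_inv g y) | y in ival @^-1` B]); split.
  + rewrite finite_setU; split => //.
    apply: finite_image; apply: finite_preimage => //.
    by move=> ? ? _ _; exact: ival_inj.
  + move=> _ [/Cd//|[y /Bd yd <-]].
    by apply/(thompsonF_dyadic _ gF); rewrite homeo_invK.
  + apply: affine_offS (affine_offM ival_inj gi fB gC) => x [Cx|Bgx].
      by left.
    by right; exists (g x); rewrite ?homeoK.
- have [fi [B [Bfin Bd fB]]] := fF.
  split; first exact: (incrV ival_inj).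
  exists [set ival (f y) | y in ival @^-1` B]; split.
  + apply: finite_image; apply: finite_preimage => //.
    by move=> ? ? _ _; exact: ival_inj.
  + by move=> _ [y /Bd yd <-]; apply/(thompsonF_dyadic _ fF).
  + apply: affine_offS (affine_offV ival_inj fi fB) => x Bfx.
    by exists (homeo_inv f x); rewrite ?homeo_invK.
Qed.

Definition thompsonF : subgroup (homeo unit_interval) :=
  Subgroup thompsonF_closed.

End ThompsonF.

Section ThompsonT.
Context (R : realType).

Definition circle_rel (x y : R) : bool := x - y \is a Num.int.

Lemma circle_rel_refl : reflexive circle_rel.
Proof. by move=> x; rewrite /circle_rel subrr rpred0. Qed.
Lemma circle_rel_sym : symmetric circle_rel.
Proof. by move=> x y; rewrite /circle_rel -opprB rpredN. Qed.
Lemma circle_rel_trans : transitive circle_rel.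
Proof.
move=> y x z xy yz; rewrite /circle_rel -(subrK y x) -addrA.
exact: rpredD.
Qed.

Canonical circle_equiv :=
  EquivRel circle_rel circle_rel_refl circle_rel_sym circle_rel_trans.

Definition circle : topologicalType := quotient_topology {eq_quot circle_rel}.

Definition circle_pi : R -> circle := \pi_({eq_quot circle_rel}).

Definition circle_dyadic : set circle := circle_pi @` dyadic.

Implicit Types (f g : homeo circle) (h : homeo R).

(* Orientation-preserving homeomorphisms of R / Z are those which lift to an
   increasing homeomorphism [h] of R with h(x + 1) = h(x) + 1. *)
Definition circle_lift (f : homeo circle) (h : homeo R) : Prop :=
  [/\ {homo h : x y / x < y},
      forall x, h (x + 1) = h x + 1 &
      forall x, f (circle_pi x) = circle_pi (h x)].

(* Breakpoints and slopes of [f] are read off on a lift; [B] contains the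
   breakpoints as points of R / Z. *)
Definition thompsonT_set : set (homeo circle) :=
  [set f : homeo circle | f @` circle_dyadic = circle_dyadic /\
     exists (h : homeo R) (B : set circle),
       [/\ circle_lift f h, finite_set B, B `<=` circle_dyadic &
           affine_off id (circle_pi @^-1` B) h]].

Lemma thompsonT_closed : group_closed (mem thompsonT_set).
Proof.
apply: homeo_closed => [|f g|f].
- split; first exact: image_id.
  exists 1%g, set0.
  split; [by split|exact: finite_set0|exact: sub0set|exact: affine_off1].
- move=> [fD [h [B [[hi h1 fh] Bfin Bd hB]]]].
  move=> [gD [k [C [[ki k1 gk] Cfin Cd kC]]]].
  split; first by rewrite -[in RHS]fD -[in RHS]gD image_comp.
  exists (h * k)%g, (C `|` homeo_inv g @` B); split.
  + split; first exact: (@incrM _ _ id).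
      by move=> x; rewrite !homeoME k1 h1.
    by move=> x; rewrite !homeoME gk fh.
  + by rewrite finite_setU; split => //; exact: finite_image.
  + move=> _ [/Cd//|[y /Bd + <-]].
    by rewrite -[in X in X -> _]gD => -[x xd <-]; rewrite homeoK.
  + apply: affine_offS (affine_offM (@inj_id R) ki hB kC) => x [Cx|Bkx].
      by left.
    by right; exists (circle_pi (k x)); rewrite // -gk homeoK.
- move=> [fD [h [B [[hi h1 fh] Bfin Bd hB]]]]; split.
    rewrite -[in LHS]fD image_comp -[RHS]image_id.
    by apply: eq_imagel => x _; exact: homeoK.
  exists (h^-1)%g, (f @` B); split.
  + split; first exact: (@incrV _ _ id).
      by move=> x; apply: (can_inj (homeoK h)); rewrite h1 !homeo_invK.
    move=> x; apply: (can_inj (homeoK f)).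
    by rewrite fh !homeo_invK.
  + exact: finite_image.
  + by move=> _ [y /Bd yd <-]; rewrite -fD; exists y.
  + apply: affine_offS (affine_offV (@inj_id R) hi hB) => x /= Bx.
    by exists (circle_pi (homeo_inv h x)); rewrite // fh homeo_invK.
Qed.

Definition thompsonT : subgroup (homeo circle) := Subgroup thompsonT_closed.

End ThompsonT.

Section ThompsonV.
Implicit Types (w : seq bool) (x y : cantor_space) (f g : homeo cantor_space).

Definition prepend w x : cantor_space :=
  fun n => if (n < size w)%N then nth false w n else x (n - size w)%N.

Definition brick w : set cantor_space := range (prepend w).

Definition thompsonV_set : set (homeo cantor_space) :=
  [set f : homeo cantor_space | exists (I : finType) (s t : I -> seq bool),
     [/\ partition [set: I] (brick \o s) [set: cantor_space],
         partition [set: I] (brick \o t) [set: cantor_space] &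
         forall i x, f (prepend (s i) x) = prepend (t i) x]].

Lemma prepend_nil x : prepend [::] x = x.
Proof. by apply/funext => n; rewrite /prepend ltn0 subn0. Qed.

Lemma prepend_cat v w x : prepend (v ++ w) x = prepend v (prepend w x).
Proof.
apply/funext => n; rewrite /prepend size_cat nth_cat.
case: (ltnP n (size v)) => vn; first by rewrite ltn_addr.
by rewrite -ltn_subLR// subnDA.
Qed.

Lemma prepend_inj w : injective (prepend w).
Proof.
move=> x y xy; apply/funext => n.
have := congr1 (fun z : cantor_space => z (size w + n)%N) xy.
by rewrite /prepend ltnNge leq_addr /= addKn.
Qed.

Lemma prepend_prefix v w x y : prepend v x = prepend w y ->
  prefix v w || prefix w v.
Proof.
move=> vw; wlog le : v w x y vw / (size v <= size w)%N.
  move=> H; have [|/ltnW] := leqP (size v) (size w); first exact: H vw.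
  by rewrite orbC; exact: H (esym vw).
apply/orP; left; rewrite prefixE; apply/eqP/(@eq_from_nth _ false).
  by rewrite size_takel.
move=> n; rewrite size_takel// => nv; rewrite nth_take//.
have := congr1 (fun z : cantor_space => z n) vw.
by rewrite /prepend nv (leq_trans nv le).
Qed.

Lemma prefix_merge v w : prefix v w || prefix w v ->
  v ++ drop (size v) w = w ++ drop (size w) v.
Proof.
have d (x y : seq bool) : drop (size (x ++ y)) x = [::].
  by rewrite drop_oversize// size_cat leq_addr.
by case/orP => /prefixP[u ->]; rewrite d drop_size_cat// cats0.
Qed.

Definition brick_sub (I J : Type) (s t : I -> seq bool) (u : J -> seq bool)
    (p : I * J) : seq bool := s p.1 ++ drop (size (t p.1)) (u p.2).

Definition brick_meet (I J : Type) (t : I -> seq bool) (u : J -> seq bool)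
    (p : I * J) : bool := prefix (t p.1) (u p.2) || prefix (u p.2) (t p.1).

Lemma brick_sub_cover (I J : Type) (s t : I -> seq bool) (u : J -> seq bool) f :
  partition [set: I] (brick \o s) [set: cantor_space] ->
  partition [set: J] (brick \o u) [set: cantor_space] ->
  (forall i x, f (prepend (s i) x) = prepend (t i) x) ->
  forall x, exists2 p, brick_meet t u p & brick (brick_sub s t u p) x.
Proof.
move=> [sc _ _] [uc _ _] fst_ x.
have [i _ [y _ xE]] : cover [set: I] (brick \o s) x by rewrite sc.
have [j _ [z _ fxE]] : cover [set: J] (brick \o u) (f x) by rewrite uc.
have tyuz : prepend (t i) y = prepend (u j) z by rewrite fxE -xE fst_.
have meet := prepend_prefix tyuz; exists (i, j) => //.
rewrite /brick_sub /=; have /orP[/prefixP[r uE]|/prefixP[r tE]] := meet.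
  exists z => //; rewrite uE drop_size_cat// prepend_cat -xE; congr prepend.
  by apply: (@prepend_inj (t i)); rewrite -prepend_cat -uE.
exists y => //; rewrite tE drop_oversize ?cats0// size_cat leq_addr//.
Qed.

Lemma brick_sub_triv (I J : Type) (s t : I -> seq bool) (u : J -> seq bool) f :
  partition [set: I] (brick \o s) [set: cantor_space] ->
  partition [set: J] (brick \o u) [set: cantor_space] ->
  (forall i x, f (prepend (s i) x) = prepend (t i) x) ->
  forall x p q, brick_meet t u p -> brick_meet t u q ->
    brick (brick_sub s t u p) x -> brick (brick_sub s t u q) x -> p = q.
Proof.
move=> [_ st _] [_ ut _] fst_ x [i j] [i' j'] m m' [y _ yE] [y' _ yE'].
have ii' : i = i'.
  apply: st => //; exists x; split.
    rewrite /brick_sub /= prepend_cat in yE.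
    by exists (prepend (drop (size (t i)) (u j)) y).
  rewrite /brick_sub /= prepend_cat in yE'.
  by exists (prepend (drop (size (t i')) (u j')) y').
have jj' : j = j'; last by rewrite ii' jj'.
apply: ut => //; exists (f x); split => /=.
  rewrite -yE /brick_sub /= prepend_cat fst_ -prepend_cat prefix_merge//.
  by rewrite prepend_cat; eexists.
rewrite -yE' /brick_sub /= prepend_cat fst_ -prepend_cat prefix_merge//.
by rewrite prepend_cat; eexists.
Qed.

Lemma thompsonV_closed : group_closed (mem thompsonV_set).
Proof.
apply: homeo_closed => [|f g|f].
- exists unit, (fun=> [::]), (fun=> [::]).
  have triv : partition [set: unit] (brick \o fun=> [::]) [set: cantor_space].
    split=> [|i j _ _ _|i _]; last by exists (prepend [::] point), point.
    + rewrite -subTset => x _; exists tt => //; exists x => //.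
      exact: prepend_nil.
    + by case: i; case: j.
  by split.
- move=> [J [u [w [up wp guw]]]] [I [s [t [sp tp fst_]]]].
  pose K : finType := {p : I * J | brick_meet t u p}.
  have wu j x : (f^-1)%g (prepend (w j) x) = prepend (u j) x.
    by rewrite homeoVE -guw homeoK.
  pose swap (p : I * J) := (p.2, p.1).
  have meetC p : brick_meet u t (swap p) = brick_meet t u p.
    by rewrite /brick_meet /= orbC.
  exists K, (fun k => brick_sub s t u (val k)),
    (fun k => brick_sub w u t (swap (val k))); split.
  + split=> [|k l _ _ [x [xk xl]]|k _].
    * rewrite -subTset => x _.
      by have [p mp xp] := brick_sub_cover sp up fst_ x; exists (exist _ p mp).
    * apply: val_inj.
      exact: (brick_sub_triv sp up fst_ (valP k) (valP l) xk xl).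
    * by eexists; exists point.
  + split=> [|k l _ _ [x [xk xl]]|k _].
    * rewrite -subTset => x _.
      have [[j i] mp xp] := brick_sub_cover wp tp wu x.
      have mp' : brick_meet t u (i, j) by rewrite -meetC.
      by exists (exist _ (i, j) mp').
    * apply: val_inj; have mk := valP k; have ml := valP l.
      rewrite -!meetC in mk ml.
      have := brick_sub_triv wp tp wu mk ml xk xl.
      by case: (val k) (val l) => [? ?] [? ?] [-> ->].
    * by eexists; exists point.
  + move=> [[i j] m] x; rewrite homeoME /brick_sub /= prepend_cat fst_.
    by rewrite -prepend_cat prefix_merge// prepend_cat guw -prepend_cat.
- move=> [I [s [t [sp tp fst_]]]]; exists I, t, s; split=> // i x.
  by rewrite homeoVE -fst_ homeoK.
Qed.

Definition thompsonV : subgroup (homeo cantor_space) :=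
  Subgroup thompsonV_closed.

End ThompsonV.

Section Wreath.
Context (G L : groupType).
Local Open Scope group_scope.
Local Open Scope fset_scope.

Definition lamps : Type := {fsfun L -> G with 1}.
Implicit Types (f g h : lamps) (a b : L).

Definition lamps_one : lamps := [fsfun with 1].

Definition lamps_mul f g : lamps :=
  [fsfun x in (finsupp f `|` finsupp g)%fset => f x * g x | 1].

Definition lamps_inv f : lamps :=
  [fsfun x in finsupp f => (f x)^-1 | 1].

(* (a . f)(x) = f(a^-1 x) *)
Definition lamps_shift a f : lamps :=
  [fsfun x in [fset a * y | y in finsupp f]%fset => f (a^-1 * x) | 1].

Lemma lamps_oneE x : lamps_one x = 1.
Proof. by rewrite fsfunE. Qed.

Lemma lamps_mulE f g x : lamps_mul f g x = f x * g x.
Proof.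
rewrite fsfunE inE; case: (finsuppP f x); case: (finsuppP g x) => //= _ _.
by rewrite mulg1.
Qed.

Lemma lamps_invE f x : lamps_inv f x = (f x)^-1.
Proof. by rewrite fsfunE; case: finsuppP => //; rewrite invg1. Qed.

Lemma lamps_shiftE a f x : lamps_shift a f x = f (a^-1 * x).
Proof.
rewrite fsfunE; case: ifPn => // /imfsetP xa.
rewrite fsfun_dflt//; apply/negP => ax; apply: xa.
by exists (a^-1 * x); rewrite // mulVKg.
Qed.

Record wreath := Wreath { wreath_lamps : lamps; wreath_top : L }.

HB.instance Definition _ := gen_eqMixin wreath.
HB.instance Definition _ := gen_choiceMixin wreath.

Definition wreath_one := Wreath lamps_one 1.

Definition wreath_mul (x y : wreath) :=
  Wreath (lamps_mul (wreath_lamps x)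
            (lamps_shift (wreath_top x) (wreath_lamps y)))
    (wreath_top x * wreath_top y).

Definition wreath_inv (x : wreath) :=
  Wreath (lamps_shift (wreath_top x)^-1 (lamps_inv (wreath_lamps x)))
    (wreath_top x)^-1.

Lemma wreathP (x y : wreath) : wreath_lamps x =1 wreath_lamps y ->
  wreath_top x = wreath_top y -> x = y.
Proof. by case: x y => [f a] [g b] /= /fsfunP -> ->. Qed.

Lemma wreath_mulA : associative wreath_mul.
Proof.
move=> x y z; apply: wreathP => [u|] /=; last by rewrite mulgA.
by rewrite !(lamps_mulE, lamps_shiftE) invgM !mulgA.
Qed.

Lemma wreath_mul1x : left_id wreath_one wreath_mul.
Proof.
move=> x; apply: wreathP => [u|] /=; last by rewrite mul1g.
by rewrite !(lamps_mulE, lamps_shiftE, lamps_oneE) invg1 !mul1g.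
Qed.

Lemma wreath_mulx1 : right_id wreath_one wreath_mul.
Proof.
move=> x; apply: wreathP => [u|] /=; last by rewrite mulg1.
by rewrite !(lamps_mulE, lamps_shiftE, lamps_oneE) mulg1.
Qed.

Lemma wreath_mulVx : left_inverse wreath_one wreath_inv wreath_mul.
Proof.
move=> x; apply: wreathP => [u|] /=; last by rewrite mulVg.
by rewrite !(lamps_mulE, lamps_shiftE, lamps_oneE, lamps_invE) mulVg.
Qed.

Lemma wreath_mulxV : right_inverse wreath_one wreath_inv wreath_mul.
Proof.
move=> x; apply: wreathP => [u|] /=; last by rewrite mulgV.
rewrite !(lamps_mulE, lamps_shiftE, lamps_oneE, lamps_invE) invgK.
by rewrite mulgA mulgV mul1g mulgV.
Qed.

HB.instance Definition _ := isGroup.Build wreath wreath_mulA wreath_mul1x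
  wreath_mulx1 wreath_mulVx wreath_mulxV.

End Wreath.

(* Main.v *)
(* If y commutes with x ^ (s_i^-1 s_j) for all i < j, where s is a sequence in
   G, then an almost homomorphism phi from G to a unitary group nearly kills
   x y (y x)^-1, whatever the dimension and the norm are. Indeed unitary groups
   are compact, so phi(s_i) is close to phi(s_j) for some i < j, hence phi(k) is
   close to 1 for k = s_i^-1 s_j. Then phi(x) is close to phi(x ^ k), which
   almost commutes with phi(y), and so phi(x) and phi(y) almost commute, up to a
   constant times the defect. Here i and j depend on phi, but the defect is
   uniform over G. If x and y do not commute, G is therefore not uniformly
   approximable.

   In a wreath product, x and y are lamps at the origin and the s_i are distinct
   elements of the top group. In Thompson's groups, x and y are supported in a
   set I which is disjoint from its images under the positive powers of some t,
   and s_i = t ^ i. *)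
Require Import Defs.
From mathcomp Require Import all_boot all_order all_algebra finmap.
From mathcomp Require Import complex.
From mathcomp Require Import all_classical all_reals all_analysis.
From mathcomp Require Import lra.

Set Implicit Arguments.
Unset Strict Implicit.
Unset Printing Implicit Defensive.

Import Order.TTheory GRing.Theory Num.Theory.
Import numFieldNormedType.Exports.

Local Open Scope classical_set_scope.
Local Open Scope ring_scope.

(** * Pigeonhole in unitary groups *)

Section NormedUnitary.
Context {R : realType} (K : normed_unitary R).
Local Notation M := 'M[R[i]]_(udim K).
Implicit Types A B C u v : M.

Definition udist A B : R := unorm (A - B).

Lemma udist_sym A B : udist A B = udist B A.
Proof.
rewrite /udist -opprB -scaleN1r unormZ.
by rewrite /Normc.normc /= oppr0 sqrrN expr1n expr0n /= addr0 sqrtr1 mul1r.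
Qed.

Lemma udist_triangle B A C : udist A C <= udist A B + udist B C.
Proof.
rewrite /udist (_ : A - C = (A - B) + (B - C)) ?unormD//.
by rewrite addrA subrK.
Qed.

Lemma unorm0 : unorm (0 : M) = 0.
Proof.
rewrite -(scale0r (0 : M)) unormZ /Normc.normc /=.
by rewrite expr0n /= addr0 sqrtr0 mul0r.
Qed.

(** The path from [0] to [A] and back has length twice the norm of [A], which the triangle
    inequality bounds below by the norm of [0]. *)
Lemma unorm_ge0 A : 0 <= unorm A.
Proof.
have := udist_triangle A 0 0; rewrite [udist 0 A]udist_sym.
rewrite /udist !subr0 unorm0; lra.
Qed.

Lemma unitarymx1 n : (1%:M : 'M[R[i]]_n) \is unitarymx.
Proof. by apply/unitarymxP; rewrite mul1mx trmx1 map_mx1. Qed.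

Lemma udistMl u A B : u \is unitarymx -> udist (u *m A) (u *m B) = udist A B.
Proof.
move=> uu; rewrite /udist -mulmxBr -[u *m _]mulmx1.
exact: unorm_biinv uu (unitarymx1 _).
Qed.

Lemma udistMr u A B : u \is unitarymx -> udist (A *m u) (B *m u) = udist A B.
Proof.
move=> uu; rewrite /udist -mulmxBl -[(A - B) *m _]mul1mx mulmxA.
exact: unorm_biinv (unitarymx1 _) uu.
Qed.

Lemma unorm_sum I (r : seq I) (F : I -> M) :
  unorm (\sum_(i <- r) F i) <= \sum_(i <- r) unorm (F i).
Proof.
elim/big_ind2: _ => [|A a B b Aa Bb|//]; first by rewrite unorm0.
exact: le_trans (unormD _ _) (lerD Aa Bb).
Qed.

Lemma normc_le (z : R[i]) d : `|complex.Re z| <= d -> `|complex.Im z| <= d ->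
  Normc.normc z <= d + d.
Proof.
case: z => a b /= ad bd; apply: le_trans (lerD ad bd).
rewrite -[leRHS]ger0_norm ?addr_ge0// -sqrtr_sqr ler_sqrt ?sqr_ge0//.
rewrite sqrrD !real_normK ?num_real// lerD2r lerDl.
by rewrite mulrn_wge0// mulr_ge0.
Qed.

(** By expansion over the matrix units, entrywise closeness forces closeness in any norm, with a
    constant depending on the norm and the dimension. *)
Lemma unorm_le_entries A d :
  (forall i j, `|complex.Re (A i j)| <= d /\ `|complex.Im (A i j)| <= d) ->
  unorm A <= (d + d) * \sum_i \sum_j unorm (delta_mx i j : M).
Proof.
move=> Ad; rewrite [A in unorm A]matrix_sum_delta mulr_sumr.
apply: le_trans (unorm_sum _ _) _; apply: ler_sum => i _; rewrite mulr_sumr.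
apply: le_trans (unorm_sum _ _) _; apply: ler_sum => j _; rewrite unormZ.
by have [re im] := Ad i j; rewrite ler_wpM2r ?unorm_ge0// normc_le.
Qed.

(** The diagonal entries of [u u^* = 1] say that the squared moduli along each row add up to 1. *)
Lemma unitarymx_entry u i j : u \is unitarymx ->
  `|complex.Re (u i j)| <= 1 /\ `|complex.Im (u i j)| <= 1.
Proof.
move=> /unitarymxP /(congr1 (fun A : M => A i i)); rewrite !mxE eqxx /=.
move=> /(congr1 (@complex.Re R)) E.
have {}E : \sum_k (complex.Re (u i k) ^+ 2 + complex.Im (u i k) ^+ 2) = 1.
  rewrite -[RHS]E raddf_sum; apply: eq_bigr => k _; rewrite !mxE.
  by case: (u i k) => a b /=; rewrite mulrN opprK.
have le1 : complex.Re (u i j) ^+ 2 + complex.Im (u i j) ^+ 2 <= 1.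
  rewrite -E (bigD1 j)//= lerDl; apply: sumr_ge0 => k _.
  by rewrite addr_ge0// sqr_ge0.
have := sqr_ge0 (complex.Re (u i j)); have := sqr_ge0 (complex.Im (u i j)).
move=> i0 r0; split; rewrite -(@expr_le1 _ 2)// real_normK ?num_real//; lra.
Qed.

(** Real and imaginary parts of the entries lie in [-1, 1]. Cutting this interval into finitely many
    cells leaves finitely many patterns, so two of the matrices share all their cells. *)
Lemma unitary_pigeonhole (u : nat -> M) e : 0 < e ->
  (forall i, u i \is unitarymx) ->
  exists i j, (i < j)%N /\ udist (u i) (u j) <= e.
Proof.
move=> e0 uu.
pose C := \sum_i \sum_j unorm (delta_mx i j : M).
have C0 : 0 <= C by do 2![apply: sumr_ge0 => ? _]; exact: unorm_ge0.
(* Cells of width [1/N] yield a distance of at most [2C/N], hence at most [e]. *)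
pose N := (Num.truncn (2 * C / e)).+1.
have N0 : 0 < N%:R :> R by rewrite ltr0n.
have NC : (N%:R^-1 + N%:R^-1) * C <= e.
  have : 2 * C / e < N%:R by exact: truncnS_gt.
  rewrite ltr_pdivrMr// => NC.
  by rewrite mulrC mulrDr -mulrDl ler_pdivrMr//; lra.
(* [N(x + 1)] ranges over [0, 2N] and reaches [2N] at [x = 1], hence [2N + 1] cells. *)
pose q (x : R) : 'I_(N + N).+1 := inord `|Num.floor (N%:R * (x + 1))|.
have qP x y : `|x| <= 1 -> `|y| <= 1 -> q x = q y -> `|x - y| <= N%:R^-1.
  have fl (z : R) : `|z| <= 1 -> 0 <= Num.floor (N%:R * (z + 1)) /\
      (`|Num.floor (N%:R * (z + 1))%R| < (N + N).+1)%N.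
    rewrite ler_norml => /andP[z1 z2].
    have f0 : 0 <= Num.floor (N%:R * (z + 1)).
      by rewrite floor_ge0 mulr_ge0//; lra.
    split=> //; rewrite ltnS -lez_nat gez0_abs// -(ler_int R).
    apply: le_trans (floor_le _) _; rewrite -pmulrn natrD; nra.
  move=> /fl[x0 xN] /fl[y0 yN] /(congr1 (@nat_of_ord _)).
  rewrite !inordK// => xy.
  have {xy}xy : Num.floor (N%:R * (x + 1)) = Num.floor (N%:R * (y + 1)).
    by rewrite -(gez0_abs x0) xy gez0_abs.
  have /andP[] := floor_itv (N%:R * (x + 1)).
  have /andP[] := floor_itv (N%:R * (y + 1)); rewrite xy rmorphD /=.
  move: (_%:~R) => f fy yf fx xf.
  rewrite -(ler_pM2l N0) mulfV ?gt_eqF// -[X in X * _]gtr0_norm// -normrM.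
  by rewrite ler_norml; lra.
pose F i : {ffun 'I_(udim K) * 'I_(udim K) -> 'I_(N + N).+1 * 'I_(N + N).+1} :=
  [ffun p => (q (complex.Re (u i p.1 p.2)), q (complex.Im (u i p.1 p.2)))].
have [i [j [ij Fij]]] : exists i j, (i < j)%N /\ F i = F j.
  pose n := #|{: {ffun 'I_(udim K) * 'I_(udim K) ->
    'I_(N + N).+1 * 'I_(N + N).+1}}|.
  have Fninj : ~ injective (fun i : 'I_n.+1 => F i).
    by move=> /leq_card; rewrite card_ord ltnn.
  apply: contrapT => noF; apply: Fninj => i j Fij; apply: val_inj => /=.
  by have [ij|ji|//] := ltngtP i j; case: noF; [exists i, j|exists j, i].
exists i, j; split=> //; apply: le_trans (unorm_le_entries _) NC => a b.
move/ffunP/(_ (a, b)): Fij; rewrite /F !ffunE => -[/= re im].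
have [rei imi] := unitarymx_entry a b (uu i).
have [rej imj] := unitarymx_entry a b (uu j).
have := qP _ _ rei rej re; have := qP _ _ imi imj im.
by rewrite !mxE; case: (u i a b) (u j a b) => [? ?] [? ?].
Qed.

End NormedUnitary.

(** * Displaced pairs *)

Definition displaced_pair (G : groupType) : Prop :=
  exists (x y : G) (s : nat -> G), ~ commute x y /\
    forall i j, (i < j)%N -> commute (x ^ ((s i)^-1 * s j))%g y.

Section Approximability.
Context {R : realType}.

(** With [z = x ^ k] one has [x k = k z], and both [phi x] and [phi z] are within [3e] of the image
    of this element. Passing from [x y] to [z y], and from [y z] to [y x], costs [6e] and two
    defects each; one last defect splits off the commutator, so [8 + 8 + 1 = 17]. *)
Lemma almost_hom_commg (G : groupType) (K : normed_unitary R)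
    (phi : G -> 'M[R[i]]_(udim K)) e (x y k : G) :
  (forall g, phi g \is unitarymx) ->
  (forall g h, udist (phi (g * h)%g) (phi g *m phi h) <= e) ->
  udist (phi k) 1%:M <= 2 * e -> commute (x ^ k)%g y ->
  udist (phi (x * y / (y * x))%g) 1%:M <= 17 * e.
Proof.
move=> pu hom kd zy.
have tri (A B C : 'M[R[i]]_(udim K)) a b :
    udist A B <= a -> udist B C <= b -> udist A C <= a + b.
  by move=> Aa Bb; apply: le_trans (udist_triangle B _ _) (lerD Aa Bb).
have mor g h : udist (phi g *m phi h) (phi (g * h)%g) <= e.
  by rewrite udist_sym.
have phik g : udist (phi g *m phi k) (phi g) <= 2 * e.
  by rewrite -[phi g in leLHS]mulmx1 -mulmxA udistMl ?mul1mx.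
have kphi g : udist (phi k *m phi g) (phi g) <= 2 * e.
  by rewrite -[phi g in X in udist _ X]mul1mx udistMr.
pose z := (x ^ k)%g.
have xz : udist (phi x) (phi z) <= 6 * e.
  have xk := tri _ _ _ _ _ (hom x k) (phik x).
  have kz := tri _ _ _ _ _ (hom k z) (kphi z).
  rewrite -conjgC udist_sym in kz.
  have := tri _ _ _ _ _ kz xk; rewrite udist_sym; lra.
have xyz : udist (phi (x * y)%g) (phi (z * y)%g) <= 8 * e.
  rewrite -(udistMr _ _ (pu y)) in xz.
  have := tri _ _ _ _ _ (tri _ _ _ _ _ (hom x y) xz) (mor z y); lra.
have yxz : udist (phi (y * z)%g) (phi (y * x)%g) <= 8 * e.
  rewrite udist_sym -(udistMl _ _ (pu y)) in xz.
  have := tri _ _ _ _ _ (tri _ _ _ _ _ (hom y z) xz) (mor y x); lra.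
rewrite -(udistMr _ _ (pu (y * x)%g)) mul1mx.
have := mor (x * y / (y * x))%g (y * x)%g; rewrite divgK => cyx.
rewrite zy in xyz; have := tri _ _ _ _ _ (tri _ _ _ _ _ cyx xyz) yxz; lra.
Qed.

Lemma displaced_pair_not_approximable (U : set (normed_unitary R))
  (G : groupType) : displaced_pair G -> ~ uniformly_approximable U G.
Proof.
move=> [x [y [s [nxy xsy]]]] [K [phi [[_ pu hom] inj]]].
have c1 : (x * y / (y * x))%g <> 1%g.
  by move=> /eqP; rewrite divg_eq1 => /eqP.
have : unorm (phi n (x * y / (y * x))%g - 1%:M) @[n --> \oo] --> 0.
  apply/cvgr0Pnorm_le => e e0; pose d := e / 17.
  have d0 : 0 < d by rewrite divr_gt0.
  have : \forall n \near \oo, (ereal_sup [set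
      (unorm (phi n (g * h)%g - phi n g *m phi n h))%:E
      | g in [set: G] & h in [set: G]] < d%:E)%E.
    by apply: (hom [set v | v < d%:E]%E); apply: open_ereal_lt';
      rewrite lte_fin.
  apply: filterS => n /ltW supd.
  have homn g h : udist (phi n (g * h)%g) (phi n g *m phi n h) <= d.
    rewrite -lee_fin; apply: le_trans supd; apply: ereal_sup_ubound.
    by exists g => //; exists h.
  have [i [j [ij sij]]] := unitary_pigeonhole d0 (fun i => pu n (s i)).
  rewrite ger0_norm ?unorm_ge0//.
  have -> : e = 17 * d by rewrite mulrC divfK.
  apply: (almost_hom_commg (pu n) homn _ (xsy i j ij)).
  (* After multiplication by [phi n (s i)], the distance from [phi n k] to 1 is at most one defect
     plus the pigeonhole bound, that is [2d]. *)
  rewrite -(udistMl _ _ (pu n (s i))) mulmx1.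
  apply: le_trans (udist_triangle (phi n (s j)) _ _) _.
  have := homn (s i) ((s i)^-1 * s j)%g; rewrite mulVKg udist_sym => sisj.
  rewrite udist_sym in sij; lra.
(* The liminf at the nontrivial commutator is thus 0, against asymptotic injectivity. *)
move=> lim0; have := inj _ c1.
rewrite (cvg_limn_einf_sup (l := 0%E)) ?ltxx//.
apply: cvg_EFin lim0; exact: nearW.
Qed.

End Approximability.

Local Open Scope group_scope.

(** * Embeddings and wreath products *)

(** Commutation relations pass to the image, and injectivity preserves their failure. This carries a
    pair from F' to F and from F to T. *)
Lemma displaced_pair_morph (G H : groupType) (f : G -> H) :
  {morph f : x y / x * y} -> injective f ->
  displaced_pair G -> displaced_pair H.
Proof.
move=> fM fI [x [y [s [nxy xsy]]]].
exists (f x), (f y), (f \o s); split=> [xy|i j ij /=].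
  by apply: nxy; apply: fI; rewrite !fM.
have fV k : f k^-1 = (f k)^-1.
  apply: (@mulgI _ (f k)); rewrite -fM !mulgV.
  by apply: (@mulgI _ (f 1)); rewrite -fM !mulg1.
by rewrite -fV -fM conjgE -fV -!fM -conjgE; have := congr1 f (xsy i j ij);
  rewrite !fM.
Qed.

(** Conjugation by a top element [k] moves the lamp of [x] from the origin to [k^-1], away from the
    lamp of [y] when [k] is nontrivial. *)
Lemma displaced_pair_wreath (G L : groupType) : infinite_set [set: L] ->
  ~ (forall x y : G, commute x y) -> displaced_pair (wreath G L).
Proof.
move=> /infiniteP /card_leP[l] /existsNP[g /existsNP[h ngh]].
pose lamp (a : G) : lamps G L := [fsfun z in [fset (1 : L)]%fset => a | 1].
have lampE a u : lamp a u = if u == 1 then a else 1 by rewrite fsfunE inE.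
pose sq n : L := val (l (exist _ n (mem_setT n))).
have sq_inj : injective sq.
  by move=> m n /val_inj/(inj (mem_setT _) (mem_setT _))[].
pose s n := Wreath (lamps_one G L) (sq n).
exists (Wreath (lamp g) 1), (Wreath (lamp h) 1), s; split.
  move=> /(congr1 (fun w => wreath_lamps w 1)) /=.
  by rewrite !(lamps_mulE, lamps_shiftE, lampE) invg1 mulg1 eqxx => /ngh.
move=> i j ij; pose k := (sq i)^-1 * sq j.
have k1 : k != 1.
  rewrite -(inj_eq (mulgI (sq i))) mulVKg mulg1.
  by apply: contraTneq ij => /sq_inj ->; rewrite ltnn.
have -> : (s i)^-1 * s j = Wreath (lamps_one G L) k.
  apply: wreathP => // u /=.
  by rewrite !(lamps_mulE, lamps_shiftE, lamps_invE, lamps_oneE) invg1 mulg1.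
apply: wreathP => [u|] /=; last by rewrite mul1g mulVg.
rewrite !(lamps_mulE, lamps_shiftE, lamps_invE, lamps_oneE, lampE).
rewrite !(mul1g, mulg1, invg1, invgK, mulVg).
have [->|_] := eqVneq u 1; last by rewrite mulg1 mul1g.
by rewrite mulg1 (negbTE k1) mul1g mulg1.
Qed.

(** * Displaced pairs in derived subgroups *)

Section Derived.
Context (G : groupType).

Lemma commutator_derived (x y : G) : [~ x, y] \in (derived G : set G).
Proof. by apply/mem_set => A [_]; apply; exists x => //; exists y. Qed.

(* [~ h^-1, r] = h (h^-1)^r consists of two commuting copies of h and h^-1. The
   displacement is needed for both (x, y) and (y, x) because the second copy is
   conjugated by the powers of t^-1. *)
Lemma displaced_pair_derived (H : set G) (r t x y : G) :
  (forall a b, H a -> H b -> H (a * b)) -> (forall a, H a -> H a^-1) ->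
  (forall a b, H a -> H b -> commute a (b ^ r)) ->
  (forall a b, H a -> H b -> a = b ^ r -> a = 1) ->
  H t -> H x -> H y -> ~ commute x y ->
  (forall m, commute (x ^ (t ^+ m.+1)) y /\ commute (y ^ (t ^+ m.+1)) x) ->
  displaced_pair (derived G).
Proof.
move=> HM HV Hr H1 Ht Hx Hy nxy txy.
pose c h : derived G := exist _ [~ h^-1, r] (commutator_derived _ _).
have cE h : val (c h) = h * h^-1 ^ r by rewrite /= commgEl invgK.
have cM a b : H a -> H b -> val (c a) * val (c b) = a * b * (a^-1 * b^-1) ^ r.
  move=> Ha Hb; have := Hr _ _ Hb (HV _ Ha); rewrite !cE conjMg.
  move: (a^-1 ^ r) (b^-1 ^ r) => a' b' ba'.
  by rewrite !mulgA -(mulgA a b) ba' mulgA.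
have HX a n : H a -> H (a ^+ n.+1).
  by move=> Ha; elim: n => // n IHn; rewrite expgS; exact: HM.
have HJ a b : H a -> H b -> H (a ^ b).
  by move=> Ha Hb; rewrite conjgE; apply: (HM); [exact: HV|exact: HM].
exists (c x), (c y), (fun n => c t ^+ n); split=> [/(congr1 val) /= cxy|].
  have /= cxyE := cM _ _ Hx Hy; have /= cyxE := cM _ _ Hy Hx.
  (* If [c x] and [c y] commuted, separating the two copies would equate an element of [H] with the
     conjugate by [r] of another; by hypothesis such an element is trivial. *)
  have E : (y * x)^-1 * (x * y) = (y^-1 * x^-1 * (x^-1 * y^-1)^-1) ^ r.
    rewrite conjMg conjVg; move: cxy; rewrite cxyE cyxE.
    move: (_ ^ r) (_ ^ r) => b a ab.
    by rewrite -(mulgK a (x * y)) ab -mulgA mulKg.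
  have yx1 : (y * x)^-1 * (x * y) = 1.
    apply: (H1 _ _ _ _ E).
      exact: (HM _ _ (HV _ (HM _ _ Hy Hx)) (HM _ _ Hx Hy)).
    apply: (HM); first exact: (HM _ _ (HV _ Hy) (HV _ Hx)).
    exact: (HV _ (HM _ _ (HV _ Hx) (HV _ Hy))).
  by apply: nxy; rewrite /commute -[LHS](mulVKg (y * x)) yx1 mulg1.
move=> i j ij.
have -> : (c t ^+ i)^-1 * c t ^+ j = c t ^+ (j - i.+1).+1.
  by rewrite -{1}(subnKC ij) addSnnS expgnDr mulKg.
move: (j - i.+1)%N => m.
set T := t ^+ m.+1; have HT : H T by exact: HX.
have cT : val (c t ^+ m.+1) = T * T^-1 ^ r.
  have -> : val (c t ^+ m.+1) = val (c t) ^+ m.+1.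
    by elim: (m) => // n; rewrite !(expgS _ n.+1) => <-.
  rewrite cE expgMn; last by apply: Hr => //; exact: HV.
  by rewrite -conjXg expVgn.
have fixJ (a b : G) : commute a b -> a ^ b = a.
  by rewrite /commute => ab; rewrite conjgE ab mulKg.
(* Each copy of [x] feels only the factor of [c t ^+ m.+1] on its own side, since [H] commutes with
   its conjugate by [r]. *)
have cJ : val (c x ^ (c t ^+ m.+1)) = x ^ T * (x^-1 ^ T^-1) ^ r.
  have -> : val (c x ^ (c t ^+ m.+1)) = val (c x) ^ val (c t ^+ m.+1) by [].
  rewrite cT cE conjMg !(conjgM _ T); congr (_ * _).
    by apply: fixJ; apply: Hr; [exact: HJ|exact: HV].
  rewrite (fixJ (x^-1 ^ r)) -?conjJg//.
  by apply/commute_sym/Hr => //; exact: HV.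
have [xTy yTx] := txy m.
have Hxr := HJ _ _ (HV _ Hx) (HV _ HT).
apply: val_inj; change (val (c x ^ (c t ^+ m.+1)) * val (c y) =
  val (c y) * val (c x ^ (c t ^+ m.+1))).
rewrite cJ cE; apply: commuteM; apply/commute_sym; apply: commuteM.
- exact/commute_sym.
- by apply: Hr.
- by apply/commute_sym/Hr; [exact: HJ|exact: HV].
(* This is the displacement of [y] from [x], conjugated by [T^-1]. *)
have xTVy : commute (x^-1 ^ T^-1) y^-1.
  apply: commuteV; rewrite conjVg; apply/commute_sym/commuteV.
  have := congr1 (fun z => z ^ T^-1) yTx.
  by rewrite (conjMg (y ^ T)) (conjMg x) conjgK.
rewrite /commute -!conjMg; congr (_ ^ r); exact/commute_sym.
Qed.

End Derived.

(** * Thompson's group F and its derived subgroup *)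

(** A point moved by [f] has an image again moved by [f], so [g] fixes both; and symmetrically. *)
Lemma homeo_commute (X : topologicalType) (f g : homeo X) :
  (forall p, f p = p \/ g p = p) -> commute f g.
Proof.
have inj (h : homeo X) : injective h := can_inj (@homeoK X h).
move=> fg; apply: homeoP => p; rewrite !homeoME.
have [fp|fp] := pselect (f p = p).
  rewrite fp; have [gp|gp] := pselect (g p = p); first by rewrite gp.
  by have [//|/inj/gp] := fg (g p).
have [/fp//|gp] := fg p; rewrite gp.
by have [/inj/fp|] := fg (f p).
Qed.

(** An increasing bijection of the line maps the interval between [g (f u - e)] and [g (f u + e)]
    into the [e]-neighbourhood of [f u]. *)
Lemma incr_can_continuous (R : realType) (f g : R -> R) :
  {homo f : x y / (x < y)%R} -> cancel g f -> continuous f.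
Proof.
move=> fi gK u; have fm : {mono f : x y / (x < y)%R}.
  exact/leW_mono/le_mono.
apply/cvgrPdist_lt => e e0; near=> x.
have : x \in `](g (f u - e))%R, (g (f u + e))%R[.
  near: x; apply: near_in_itvoo.
  by rewrite in_itv /= -fm -[X in _ && X]fm !gK; lra.
rewrite in_itv /= -fm -[X in _ && X]fm !gK => /andP[xl xr].
by rewrite ltr_norml; lra.
Unshelve. all: by end_near. Qed.

(** * A piecewise linear bump and its membership in F *)

Section Bump.
Context {R : realType}.
Local Open Scope ring_scope.
Variables (a L : R).

(* The standard generator x_0 of F, rescaled to [a, a + L] and extended by the
   identity. *)
Definition plbump (u : R) : R :=
  if u <= a then u else if u <= a + L / 4 then 2 * u - a
  else if u <= a + L / 2 then u + L / 4
  else if u <= a + L then (u + a + L) / 2 else u.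

Definition plbump_inv (u : R) : R :=
  if u <= a then u else if u <= a + L / 2 then (u + a) / 2
  else if u <= a + 3 * L / 4 then u - L / 4
  else if u <= a + L then 2 * u - a - L else u.

Lemma plbumpK : cancel plbump plbump_inv.
Proof.
by move=> u; rewrite /plbump; do !case: leP => ?; rewrite /plbump_inv;
  do !case: leP => ?; lra.
Qed.

Lemma plbump_invK : cancel plbump_inv plbump.
Proof.
by move=> u; rewrite /plbump_inv; do !case: leP => ?; rewrite /plbump;
  do !case: leP => ?; lra.
Qed.

Lemma plbump_incr : {homo plbump : x y / x < y}.
Proof.
move=> x y xy; rewrite /plbump.
by do 2![case: (leP _ a) => ?; try case: (leP _ (a + L / 4)) => ?;
  try case: (leP _ (a + L / 2)) => ?; try case: (leP _ (a + L)) => ?]; lra.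
Qed.

Lemma plbump_shift u : 0 < L -> a + L / 4 <= u <= a + L / 2 ->
  plbump u = u + L / 4.
Proof.
move=> L0 /andP[u1 u2]; rewrite /plbump u2.
by case: (leP u a) => ?; [lra|case: (leP u (a + L / 4)) => ?; lra].
Qed.

Lemma plbump_outside u : 0 < L -> (u <= a) || (a + L <= u) -> plbump u = u.
Proof.
move=> L0; rewrite /plbump; case: (leP u a) => //= ? u1.
case: (leP u (a + L / 4)) => ?; [lra|].
by case: (leP u (a + L / 2)) => ?; [lra|case: (leP u (a + L)) => ?; lra].
Qed.

End Bump.

Section UnitInterval.
Context {R : realType}.
Local Open Scope ring_scope.

Lemma unit_interval_subproof (u : R) :
  0 <= u <= 1 -> u \in (`[0, 1]%classic : set R).
Proof. by move=> u01; rewrite inE /= in_itv. Qed.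

Definition unit_point (u : R) (u01 : 0 <= u <= 1) : unit_interval R :=
  exist _ u (unit_interval_subproof u01).

Lemma ival_unit_point u (u01 : 0 <= u <= 1) : ival (unit_point u01) = u.
Proof. by []. Qed.

(** The interval carries the initial topology of [ival], so continuity can be tested after
    composition with [ival]. *)
Lemma unit_interval_continuous (f : unit_interval R -> unit_interval R)
    (g : R -> R) : continuous g -> (forall p, ival (f p) = g (ival p)) ->
  continuous f.
Proof.
move=> gc fg; apply: continuous_comp_initial.
rewrite (_ : _ \o f = g \o @ival R); last by apply/funext => p; exact: fg.
by move=> p; apply: continuous_comp; [exact: initial_continuous|exact: gc].
Qed.

End UnitInterval.

Section BumpF.
Context {R : realType}.
Local Open Scope ring_scope.
Variables (a L : R).
Hypothesis (a0 : 0 <= a) (aL1 : a + L <= 1).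

Lemma plbump_unit (u : R) : 0 <= u <= 1 -> 0 <= plbump a L u <= 1.
Proof.
move: (a0) (aL1) => ? ? /andP[u0 u1]; rewrite /plbump.
by case: (leP u a) => ?; [|case: (leP u (a + L / 4)) => ?;
  [|case: (leP u (a + L / 2)) => ?; [|case: (leP u (a + L)) => ?]]];
  apply/andP; split; lra.
Qed.

Lemma plbump_inv_unit (u : R) : 0 <= u <= 1 -> 0 <= plbump_inv a L u <= 1.
Proof.
move: (a0) (aL1) => ? ? /andP[u0 u1]; rewrite /plbump_inv.
by case: (leP u a) => ?; [|case: (leP u (a + L / 2)) => ?;
  [|case: (leP u (a + 3 * L / 4)) => ?; [|case: (leP u (a + L)) => ?]]];
  apply/andP; split; lra.
Qed.

Let plbumpI (p : unit_interval R) :=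
  unit_point (plbump_unit (unit_intervalP p)).
Let plbumpI_inv (p : unit_interval R) :=
  unit_point (plbump_inv_unit (unit_intervalP p)).

Let plbumpIK : cancel plbumpI plbumpI_inv.
Proof. by move=> p; apply: ival_inj; exact: plbumpK. Qed.
Let plbumpI_invK : cancel plbumpI_inv plbumpI.
Proof. by move=> p; apply: ival_inj; exact: plbump_invK. Qed.

Lemma plbump_inv_incr : {homo plbump_inv a L : x y / x < y}.
Proof.
move=> x y xy; rewrite ltNge; apply/negP => yx.
have := le_mono (plbump_incr a L) (plbump_inv a L y) (plbump_inv a L x).
by rewrite !plbump_invK yx leNgt xy.
Qed.

Let plbumpI_continuous : continuous plbumpI.
Proof.
by apply: (@unit_interval_continuous R _ (plbump a L)) => //;
  exact: incr_can_continuous (@plbump_incr _ _ _) (@plbump_invK _ _ _).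
Qed.
Let plbumpI_inv_continuous : continuous plbumpI_inv.
Proof.
by apply: (@unit_interval_continuous R _ (plbump_inv a L)) => //;
  exact: incr_can_continuous plbump_inv_incr (@plbumpK _ _ _).
Qed.

Definition plbump_homeo : homeo (unit_interval R) :=
  Homeo plbumpIK plbumpI_invK plbumpI_continuous plbumpI_inv_continuous.

Lemma plbump_thompsonF : 0 < L -> dyadic a -> dyadic L ->
  thompsonF_set plbump_homeo.
Proof.
move=> L0 da dL; split; first by move=> p q pq; exact: plbump_incr.
exists [set a; a + L / 4; a + L / 2; a + L]; split.
- by rewrite !finite_setU; do !split; exact: finite_set1.
- have d4 : dyadic (L / 4).
    rewrite (_ : L / 4 = 2 ^ (- 2%:Z) * L); first exact: dyadic_exp.
    by rewrite -exprnN; lra.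
  have d2 : dyadic (L / 2).
    by rewrite (_ : L / 2 = L / 4 + L / 4); [exact: dyadicD|lra].
  by move=> _ [[[->|->]|->]|->] //; exact: dyadicD.
move=> p q pq.
(* No breakpoint lies strictly between [p] and [q], so each one is on the left of both or on the
   right of both. *)
have cut b : 0 <= b <= 1 -> [set a; a + L / 4; a + L / 2; a + L] b ->
    b <= ival p \/ ival q <= b.
  move=> b01 Bb; have [|pb] := leP b (ival p); first by left.
  have [|bq] := leP (ival q) b; first by right.
  by case: (pq (unit_point b01)); rewrite ?ival_unit_point ?pb.
have aff (k : int) c : (forall u, ival p <= u <= ival q ->
    plbump a L u = 2 ^ k * u + c) -> exists k c, forall x,
    ival p <= ival x <= ival q -> ival (plbump_homeo x) = 2 ^ k * ival x + c.
  by move=> plbumpE; exists k, c => x pxq; exact: plbumpE.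
move: (a0) (aL1) => ? ?.
(* Testing the breakpoints from left to right locates the interval in one of five pieces, with
   slopes 1, 2, 1, 1/2 and 1. *)
have [||ap|qa] := cut a;
    [by apply/andP; split; lra|by do 3!left| |]; last first.
  apply: (aff 0 0) => u /andP[pu uq].
  by rewrite expr0z /plbump (le_trans uq qa); lra.
have [||bp|qb] := cut (a + L / 4);
    [by apply/andP; split; lra|by do 2!left; right| |]; last first.
  apply: (aff 1 (- a)) => u /andP[pu uq]; rewrite expr1z /plbump.
  case: (leP u a) => ?; [lra|case: (leP u (a + L / 4)) => ?; lra].
have [||cp|qc] := cut (a + L / 2);
    [by apply/andP; split; lra|by left; right| |]; last first.
  apply: (aff 0 (L / 4)) => u /andP[pu uq]; rewrite expr0z /plbump.
  case: (leP u a) => ?; [lra|case: (leP u (a + L / 4)) => ?; [lra|]].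
  by case: (leP u (a + L / 2)) => ?; lra.
have [||dp|qd] := cut (a + L);
    [by apply/andP; split; lra|by right| |]; last first.
  apply: (aff (-1) ((a + L) / 2)) => u /andP[pu uq]; rewrite exprN1 /plbump.
  case: (leP u a) => ?; [lra|case: (leP u (a + L / 4)) => ?; [lra|]].
  by case: (leP u (a + L / 2)) => ?; [lra|case: (leP u (a + L)) => ?; lra].
apply: (aff 0 0) => u /andP[pu uq]; rewrite expr0z /plbump.
case: (leP u a) => ?; [lra|case: (leP u (a + L / 4)) => ?; [lra|]].
by case: (leP u (a + L / 2)) => ?; [lra|case: (leP u (a + L)) => ?; lra].
Qed.

End BumpF.

Section ThompsonF.
Context {R : realType}.
Local Open Scope ring_scope.

Lemma dyadic_frac (m n : nat) : dyadic (m%:R / 2 ^+ n : R).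
Proof. by exists m%:Z, n. Qed.

(** With natural parameters, the range conditions become numerical tests that are evaluated at each
    use. *)
Lemma bump_thompsonF (m n k : nat) : (m + n <= 2 ^ k)%N -> (0 < n)%N ->
  exists f : thompsonF R, forall p,
    ival (\val f p) = plbump (m%:R / 2 ^+ k) (n%:R / 2 ^+ k) (ival p).
Proof.
move=> mnk n0; have k0 : 0 < 2 ^+ k :> R by rewrite exprn_gt0.
have a0 : 0 <= m%:R / 2 ^+ k :> R by rewrite divr_ge0// ltW.
have aL : m%:R / 2 ^+ k + n%:R / 2 ^+ k <= 1 :> R.
  by rewrite -mulrDl ler_pdivrMr// mul1r -natrD -natrX ler_nat.
have fF : plbump_homeo a0 aL \in subgroup_set (thompsonF R).
  apply/mem_set/plbump_thompsonF; [|exact: dyadic_frac..].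
  by rewrite divr_gt0// ltr0n.
by exists (exist (fun f => f \in subgroup_set (thompsonF R)) _ fF).
Qed.

End ThompsonF.

(** * A displaced pair in F' *)

Section DisplacedF.
Context {R : realType}.
Local Open Scope ring_scope.

Lemma thompsonF_commute (f g : thompsonF R) :
  (forall p, \val f p = p \/ \val g p = p) -> commute f g.
Proof. by move=> fg; apply: val_inj; exact: homeo_commute. Qed.

Lemma thompsonF_conjE (f g : thompsonF R) p :
  \val (f ^ g)%g p = homeo_inv (\val g) (\val f (\val g p)).
Proof. by []. Qed.

Lemma thompsonF_conj_fix (f g : thompsonF R) p :
  \val f (\val g p) = \val g p -> \val (f ^ g)%g p = p.
Proof. by move=> fgp; rewrite thompsonF_conjE fgp homeoK. Qed.

Lemma displaced_pair_thompsonF' : displaced_pair (derived (thompsonF R)).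
Proof.
(* r moves K = ]1/4, 1/2[ off itself, and inside K the positive powers of t move
   I = ]5/16, 3/8[, which contains the supports of x and y, off itself. *)
have [r rE] := @bump_thompsonF R 0 1 0 isT isT.
have [t tE] := @bump_thompsonF R 1 1 2 isT isT.
have [x xE] := @bump_thompsonF R 5 1 4 isT isT.
have [y yE] := @bump_thompsonF R 10 1 5 isT isT.
(* The elements supported in K play the role of [H] in [displaced_pair_derived]. *)
pose H : set (thompsonF R) :=
  [set f : thompsonF R | forall p, ~~ (1 / 4 < ival p < 1 / 2) -> \val f p = p].
have bE (f : thompsonF R) (m n k : nat) :
    (forall p, ival (\val f p) =
      plbump (m%:R / 2 ^+ k) (n%:R / 2 ^+ k) (ival p)) ->
    (0 < n)%N ->
    forall p, (ival p <= m%:R / 2 ^+ k) || ((m + n)%:R / 2 ^+ k <= ival p) ->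
    \val f p = p.
  move=> fE n0 p pmn; apply: ival_inj; rewrite fE plbump_outside//.
    by rewrite divr_gt0 ?ltr0n// exprn_gt0.
  by rewrite -mulrDl -natrD.
(* [r] translates K by 1/4 onto ]1/2, 3/4[, where elements of [H] act trivially. *)
have HrK a p : H a -> 1 / 4 < ival p < 1 / 2 -> \val (a ^ r)%g p = p.
  move=> Ha /andP[p1 p2]; apply/thompsonF_conj_fix/Ha.
  rewrite rE negb_and -!leNgt /plbump.
  case: (leP (ival p)) => ?; first lra.
  case: (leP (ival p)) => ?; first lra.
  by case: (leP (ival p)) => ?; apply/orP; right; lra.
apply: (@displaced_pair_derived _ H r t x y).
- move=> a b Ha Hb p pK.
  by have -> : \val (a * b)%g p = \val a (\val b p) by []; rewrite Hb ?Ha.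
- move=> a Ha p pK.
  have -> : \val a^-1%g p = homeo_inv (\val a) p by [].
  by rewrite -[in LHS](Ha p pK) homeoK.
- move=> a b Ha Hb; apply: thompsonF_commute => p.
  by have [pK|/Ha] := boolP (1 / 4 < ival p < 1 / 2); [right; exact: HrK|left].
- move=> a b Ha Hb ab; apply/val_inj/homeoP => p.
  have [pK|/Ha//] := boolP (1 / 4 < ival p < 1 / 2).
  by rewrite ab HrK.
- move=> p pK; apply: (bE _ _ _ _ tE isT).
  apply: contraNT pK; rewrite negb_or -!ltNge => /andP[? ?].
  by apply/andP; split; lra.
- move=> p pK; apply: (bE _ _ _ _ xE isT).
  apply: contraNT pK; rewrite negb_or -!ltNge => /andP[? ?].
  by apply/andP; split; lra.
- move=> p pK; apply: (bE _ _ _ _ yE isT).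
  apply: contraNT pK; rewrite negb_or -!ltNge => /andP[? ?].
  by apply/andP; split; lra.
- (* y moves 21/64, which x maps to the right end 11/32 of the support of y. *)
  have q01 : 0 <= (21 / 64 : R) <= 1 by apply/andP; split; lra.
  move=> /(congr1 (fun f : thompsonF R => ival (\val f (unit_point q01)))).
  have comE (f g : thompsonF R) p : \val (f * g)%g p = \val f (\val g p) by [].
  have yq : ival (\val y (unit_point q01)) = 43 / 128.
    by rewrite yE ival_unit_point plbump_shift; [|lra|apply/andP; split]; lra.
  have xq : ival (\val x (unit_point q01)) = 22 / 64.
    by rewrite xE ival_unit_point plbump_shift; [|lra|apply/andP; split]; lra.
  rewrite !comE (bE _ _ _ _ yE isT (\val x (unit_point q01))) ?xq; last first.
    by apply/orP; right; lra.
  by rewrite xE yq plbump_shift; [|lra|apply/andP; split]; lra.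
(* [t] translates [5/16, 6/16] by 1/16, and no point is moved to the left, so once beyond 6/16 an
   orbit stays there. *)
have t1 p : 5 / 16 < ival p -> 6 / 16 <= ival (\val t p).
  move=> p5; rewrite tE /plbump; case: (leP (ival p)) => ?; [lra|].
  case: (leP (ival p)) => ?; [lra|case: (leP (ival p)) => ?; [lra|]].
  by case: (leP (ival p)) => ?; lra.
have tm m p : 5 / 16 < ival p -> 6 / 16 <= ival (\val (t ^+ m.+1)%g p).
  elim: m p => [|m IHm] p p5; first by rewrite expg1; exact: t1.
  have -> : \val (t ^+ m.+2)%g p = \val t (\val (t ^+ m.+1)%g p).
    by rewrite expgS.
  by apply: t1; apply: lt_le_trans (IHm p p5); lra.
(* Stated for any two elements supported in I, this serves both [(x, y)] and [(y, x)]. *)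
have displaced (f g : thompsonF R) m :
    (forall p, (ival p <= 5 / 16) || (6 / 16 <= ival p) -> \val f p = p) ->
    (forall p, (ival p <= 5 / 16) || (6 / 16 <= ival p) -> \val g p = p) ->
    commute (f ^ (t ^+ m.+1))%g g.
  move=> fI gI; apply: thompsonF_commute => p.
  have [p5|p5] := leP (ival p) (5 / 16); first by right; rewrite gI ?p5.
  by left; apply: thompsonF_conj_fix; rewrite fI// tm ?orbT.
have xI p : (ival p <= 5 / 16) || (6 / 16 <= ival p) -> \val x p = p.
  move=> pI; apply: (bE _ _ _ _ xE isT).
  by case/orP: pI => pI; apply/orP; [left|right]; lra.
have yI p : (ival p <= 5 / 16) || (6 / 16 <= ival p) -> \val y p = p.
  move=> pI; apply: (bE _ _ _ _ yE isT).
  by case/orP: pI => pI; apply/orP; [left|right]; lra.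
by move=> m; split; exact: displaced.
Qed.

End DisplacedF.

(** * Periodization: from F to T *)

Section ThompsonT.
Context {R : realType}.
Local Open Scope ring_scope.
Implicit Types (f g : homeo (unit_interval R)) (u : R).

Definition ifloor u : R := (Num.floor u)%:~R.

Lemma frac_subproof u : 0 <= u - ifloor u <= 1.
Proof.
have := floor_itv u; rewrite rmorphD /= /ifloor => /andP[? ?].
by apply/andP; split; lra.
Qed.

Definition frac u : unit_interval R := unit_point (frac_subproof u).

Lemma frac_lt1 u : ival (frac u) < 1.
Proof.
have /andP[_] := floor_itv u.
by rewrite rmorphD /= ival_unit_point /ifloor; lra.
Qed.

Lemma ifloorDz u (z : int) : ifloor (u + z%:~R) = ifloor u + z%:~R.
Proof. by rewrite /ifloor floorDrz ?intr_int// intrKfloor rmorphD. Qed.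

Lemma fracDz u (z : int) : frac (u + z%:~R) = frac u.
Proof. by apply: ival_inj; rewrite !ival_unit_point ifloorDz; lra. Qed.

(** Gluing the ends of the interval turns [f] into a circle map; this is its lift to the line, a
    translated copy of [f] on each [n, n+1]. *)
Definition periodize f u : R := ifloor u + ival (f (frac u)).

Lemma periodizeDz f u (z : int) :
  periodize f (u + z%:~R) = periodize f u + z%:~R.
Proof. by rewrite /periodize fracDz ifloorDz addrAC. Qed.

Section Increasing.
Variable (f : homeo (unit_interval R)).
Hypothesis (fi : {homo f : x y / ival x < ival y}).

(** Hence [f] maps fractional parts to fractional parts, and [periodize] preserves integer parts. *)
Lemma ival_incr_lt1 p : ival p < 1 -> ival (f p) < 1.
Proof.
have i1 : 0 <= (1 : R) <= 1 by rewrite ler01 lexx.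
move=> p1; have /fi : ival p < ival (unit_point i1) by [].
move=> /lt_le_trans; apply.
by have /andP[] := unit_intervalP (f (unit_point i1)).
Qed.

Lemma ifloor_periodize u : ifloor (periodize f u) = ifloor u.
Proof.
rewrite /ifloor (@floor_def _ _ (Num.floor u))//.
have := ival_incr_lt1 (frac_lt1 u); have /andP[] := unit_intervalP (f (frac u)).
by rewrite rmorphD /= /periodize /ifloor => ? ? ?; apply/andP; split; lra.
Qed.

Lemma frac_periodize u : frac (periodize f u) = f (frac u).
Proof.
by apply: ival_inj; rewrite ival_unit_point ifloor_periodize /periodize; lra.
Qed.

Lemma periodize_incr : {homo periodize f : u v / u < v}.
Proof.
move=> u v uv; rewrite /periodize.
have [uvE|uvN] := eqVneq (Num.floor u) (Num.floor v).
  rewrite /ifloor uvE ltrD2l; apply: fi.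
  by rewrite !ival_unit_point /ifloor uvE; lra.
have : (Num.floor u + 1 <= Num.floor v).
  by rewrite lezD1 lt_neqAle uvN le_floor// ltW.
rewrite -(ler_int R) rmorphD /= -/(ifloor u) -/(ifloor v).
have := ival_incr_lt1 (frac_lt1 u); have /andP[] := unit_intervalP (f (frac v)).
lra.
Qed.

End Increasing.

Lemma periodizeM f g u : {homo g : x y / ival x < ival y} ->
  periodize (f * g)%g u = periodize f (periodize g u).
Proof.
by move=> gi; rewrite [RHS]/periodize ifloor_periodize// frac_periodize.
Qed.

Lemma periodize1 u : periodize 1%g u = u.
Proof. by rewrite /periodize homeo1E ival_unit_point; lra. Qed.

Lemma circle_piP (u v : R) :
  circle_pi u = circle_pi v <-> exists z : int, u = v + z%:~R.
Proof.
split=> [/eqmodP/= /intrP[z uv]|[z ->]].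
  by exists z; rewrite -uv addrC subrK.
by apply/eqmodP; rewrite /= /circle_rel addrAC subrr add0r intr_int.
Qed.

Lemma circle_pi_repr (x : circle R) : circle_pi (repr x) = x.
Proof. exact: reprK. Qed.

Lemma periodize_circle_pi f (u v : R) : circle_pi u = circle_pi v ->
  circle_pi (periodize f u) = circle_pi (periodize f v).
Proof.
by move=> /circle_piP[z ->]; apply/circle_piP; exists z; rewrite periodizeDz.
Qed.

Section Circle.
Variable (f : thompsonF R).
Let fF : thompsonF_set (\val f) := set_mem (valP f).
Let fVF : thompsonF_set (\val f^-1%g) := set_mem (valP f^-1%g).

Lemma periodizeK : cancel (periodize (\val f)) (periodize (\val f^-1%g)).
Proof.
move=> u; rewrite -periodizeM; last by case: (fF).
by rewrite -[RHS]periodize1 -(mulVg (\val f)).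
Qed.

Lemma periodize_invK : cancel (periodize (\val f^-1%g)) (periodize (\val f)).
Proof.
move=> u; rewrite -periodizeM; last by case: (fVF).
by rewrite -[RHS]periodize1 -(mulgV (\val f)).
Qed.

Lemma periodize_continuous : continuous (periodize (\val f)).
Proof.
apply: incr_can_continuous periodize_invK.
by apply: periodize_incr; case: (fF).
Qed.

(** The composite [g] is continuous on the line and constant on classes modulo the integers, so it
    descends to the quotient whatever representatives [repr] picks. *)
Lemma circle_map_continuous :
  continuous (fun x : circle R => circle_pi (periodize (\val f) (repr x))).
Proof.
pose g : R -> circle R := @circle_pi R \o periodize (\val f).
have gc : continuous g.
  move=> u; apply: continuous_comp; first exact: periodize_continuous.
  exact: pi_continuous.
apply: (@repr_comp_continuous R {eq_quot (@circle_rel R)}%qT _ g gc).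
by move=> u v /eqP uv; apply/eqP/periodize_circle_pi.
Qed.

End Circle.

Section CircleHomeo.
Variable (f : thompsonF R).

Let circ (g : thompsonF R) (x : circle R) : circle R :=
  circle_pi (periodize (\val g) (repr x)).

Let circ_pi (g : thompsonF R) (u : R) :
  circ g (circle_pi u) = circle_pi (periodize (\val g) u).
Proof. by apply: periodize_circle_pi; rewrite circle_pi_repr. Qed.

Let circK : cancel (circ f) (circ f^-1%g).
Proof.
by move=> x; rewrite {2}/circ circ_pi periodizeK circle_pi_repr.
Qed.
Let circVK : cancel (circ f^-1%g) (circ f).
Proof.
by move=> x; rewrite {2}/circ circ_pi periodize_invK circle_pi_repr.
Qed.

Definition circle_homeo : homeo (circle R) :=
  Homeo circK circVK (@circle_map_continuous f) (@circle_map_continuous f^-1%g).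

Definition periodize_homeo : homeo R :=
  Homeo (periodizeK f) (periodize_invK f) (@periodize_continuous f)
    (@periodize_continuous f^-1%g).

Lemma circle_homeo_pi u :
  circle_homeo (circle_pi u) = circle_pi (periodize (\val f) u).
Proof. exact: circ_pi. Qed.

Lemma thompsonF_fix1 p : ival p = 1 -> ival (\val f p) = 1.
Proof.
have [fi _] := set_mem (valP f); move=> p1; apply/eqP; rewrite eq_le.
have /andP[_ ->] := unit_intervalP (\val f p); rewrite /= -[X in X <= _]p1.
rewrite -[X in ival X <= _](homeo_invK (\val f)).
rewrite (incr_mono_le (@ival_inj R) fi).
by rewrite p1; have /andP[] := unit_intervalP (homeo_inv (\val f) p).
Qed.

Lemma dyadic_int (z : int) : dyadic (z%:~R : R).
Proof. by exists z, 0%N; rewrite expr0 divr1. Qed.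

Lemma periodize_dyadic u : dyadic u -> dyadic (periodize (\val f) u).
Proof.
move=> du; apply: dyadicD; first exact: dyadic_int.
apply/(thompsonF_dyadic _ (set_mem (valP f))).
by apply: dyadicB du _; exact: dyadic_int.
Qed.

(** Since [B] contains 0, all integers count as breakpoints, so an interval free of breakpoints
    stays within one cell [n, n+1], where the lift is a translate of [f]. *)
Lemma periodize_affine (B : set R) : B 0 ->
  affine_off (@ival R) (@ival R @^-1` B) (\val f) ->
  affine_off id (@circle_pi R @^-1` (@circle_pi R @` B)) periodize_homeo.
Proof.
move=> B0 fB a b ab.
have [ba|ltab] := leP b a.
  exists 0, (periodize (\val f) a - a) => x /andP[ax xb].
  have -> : x = a by apply/eqP; rewrite eq_le ax (le_trans xb ba).
  by rewrite expr0z /=; lra.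
have bn : b <= ifloor a + 1.
  rewrite leNgt; apply/negP => nb.
  apply: (ab (ifloor a + 1)); first rewrite nb andbT.
    by have /andP[_] := floor_itv a; rewrite rmorphD.
  exists 0 => //; apply/circle_piP; exists (- (Num.floor a + 1)).
  by rewrite rmorphN rmorphD /= /ifloor; lra.
have na : ifloor a <= a by exact: floor_le.
have pa : 0 <= a - ifloor a <= 1 by exact: frac_subproof.
have pb : 0 <= b - ifloor a <= 1 by apply/andP; split; lra.
have [|k [c fkc]] := fB (unit_point pa) (unit_point pb).
  move=> p /andP[/= ap pb'] Bp; apply: (ab (ival p + ifloor a)).
    by rewrite !ival_unit_point in ap pb'; apply/andP; split; lra.
  by exists (ival p) => //; apply/circle_piP; exists (- Num.floor a);
    rewrite rmorphN /= addrK.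
exists k, (c + ifloor a - 2 ^ k * ifloor a) => x /andP[ax xb] /=.
have px : 0 <= x - ifloor a <= 1 by apply/andP; split; lra.
have := fkc (unit_point px); rewrite !ival_unit_point !lerD2r ax xb.
move=> /(_ isT) fx.
rewrite [X in _ = X](_ : _ = 2 ^ k * (x - ifloor a) + c + ifloor a).
  rewrite -fx /periodize; have [xn|nx] := ltP x (ifloor a + 1).
    have xa : ifloor x = ifloor a.
      congr (_%:~R); apply: floor_def; rewrite rmorphD /= -/(ifloor a) xn andbT.
      exact: le_trans na ax.
    rewrite xa addrC; congr (ival (\val f _) + _).
    by apply: ival_inj; rewrite !ival_unit_point xa.
  (* The right end of the cell has the next integer as its floor; the two formulas agree there
     because [f] fixes 0 and 1. *)
  have xE : x = (Num.floor a + 1)%:~R.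
    by apply/eqP; rewrite eq_le rmorphD /= nx (le_trans xb bn).
  have xfl : ifloor x = ifloor a + 1 by rewrite /ifloor xE intrKfloor rmorphD.
  rewrite (@thompsonF_fix0 R _ (frac x) (set_mem (valP f))) ?thompsonF_fix1
    ?ival_unit_point.
  - by rewrite xfl; lra.
  - by rewrite xE rmorphD /= /ifloor; lra.
  - by rewrite xfl xE rmorphD /= /ifloor; lra.
by rewrite mulrBr; lra.
Qed.

Lemma circle_homeo_dyadic :
  circle_homeo @` @circle_dyadic R `<=` @circle_dyadic R.
Proof.
move=> _ [_ [u du <-] <-]; rewrite circle_homeo_pi.
by exists (periodize (\val f) u) => //; exact: periodize_dyadic.
Qed.

End CircleHomeo.

Lemma circle_thompsonT (f : thompsonF R) :
  circle_homeo f \in subgroup_set (thompsonT R).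
Proof.
apply/mem_set; split.
  apply/seteqP; split; first exact: circle_homeo_dyadic.
  (* The reverse inclusion is the direct one applied to the inverse. *)
  move=> x dx; exists (circle_homeo f^-1%g x).
    by apply: circle_homeo_dyadic; exists x.
  exact: (homeo_invK (circle_homeo f)).
have [fi [B [Bfin Bd fB]]] := set_mem (valP f).
(* The slopes of [f] at the two ends may differ, which makes the glued point a breakpoint. *)
exists (periodize_homeo f), (@circle_pi R @` (0 |` B)); split.
- split; [exact: periodize_incr|exact: (fun x => periodizeDz _ x 1)|].
  by move=> x; exact: circle_homeo_pi.
- by apply: finite_image; rewrite finite_setU; split => //; exact: finite_set1.
- by apply: image_subset => _ [->|/Bd//]; exact: dyadic0.
- by apply: periodize_affine; [left|apply: affine_offS fB => x; right].
Qed.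

Definition circle_morph (f : thompsonF R) : thompsonT R :=
  exist (fun h => h \in subgroup_set (thompsonT R)) _ (circle_thompsonT f).

Lemma circle_morphM : {morph circle_morph : f g / (f * g)%g >-> (f * g)%g}.
Proof.
move=> f g; apply/val_inj/homeoP => x; rewrite -[x]circle_pi_repr.
have -> : \val (circle_morph f * circle_morph g)%g =
  (circle_homeo f * circle_homeo g)%g by [].
rewrite homeoME !circle_homeo_pi -periodizeM//.
by case: (set_mem (valP g)).
Qed.

(** Points below 1 have images in [0, 1[, where the projection to the circle is injective; the end 1
    is fixed. *)
Lemma circle_morph_inj : injective circle_morph.
Proof.
move=> f g fg; apply/val_inj/homeoP => p; apply: ival_inj.
have [p1|p1] := eqVneq (ival p) 1; first by rewrite !thompsonF_fix1.
have {}p1 : ival p < 1.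
  by rewrite lt_neqAle p1; have /andP[] := unit_intervalP p.
have fl0 (h : thompsonF R) : Num.floor (ival (\val h p)) = 0.
  apply: floor_def; rewrite add0r.
  have /andP[-> _] := unit_intervalP (\val h p).
  by apply: ival_incr_lt1 => //; case: (set_mem (valP h)).
have perE (h : thompsonF R) : periodize (\val h) (ival p) = ival (\val h p).
  (* The identity of F gives the floor of [p] itself. *)
  have p0 : ifloor (ival p) = 0 by rewrite /ifloor (fl0 1%g).
  rewrite /periodize p0 add0r; congr (ival (\val h _)).
  by apply: ival_inj; rewrite ival_unit_point p0 subr0.
have : circle_homeo f (circle_pi (ival p)) =
    circle_homeo g (circle_pi (ival p)).
  by have := congr1 (fun h : thompsonT R => \val h (circle_pi (ival p))) fg.
rewrite !circle_homeo_pi !perE => /circle_piP[z fgz].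
have := fl0 f; rewrite fgz floorDrz ?intr_int// fl0 intrKfloor add0r => z0.
by rewrite z0 addr0.
Qed.

Lemma displaced_pair_thompsonT : displaced_pair (thompsonF R) ->
  displaced_pair (thompsonT R).
Proof. exact: displaced_pair_morph circle_morphM circle_morph_inj. Qed.

End ThompsonT.

(** * Prefix codes and Thompson's group V *)

Section PrefixCode.
Local Open Scope nat_scope.
Implicit Types (x y : cantor_space) (w : seq bool) (S T : seq (seq bool)).

Lemma coordinate_nbhs x (n : nat) : nbhs x [set y : cantor_space | y n = x n].
Proof.
have projx := @proj_continuous nat (fun=> bool) n x.
exact: (projx [set x n] (discrete_set1 _)).
Qed.

Lemma cylinder_nbhs x (M : nat) :
  nbhs x [set y : cantor_space | forall m, m < M -> y m = x m].
Proof.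
elim: M => [|M IHM]; first by apply: filterS filterT => y _ [].
apply: filterS (filterI IHM (coordinate_nbhs x M)) => y [yM yx] m.
by rewrite ltnS leq_eqVlt => /orP[/eqP->//|]; exact: yM.
Qed.

(** In the product topology it suffices that, near each point, every output bit depends on finitely
    many input bits. *)
Lemma cantor_continuous (f : cantor_space -> cantor_space) :
  (forall x n, exists M, forall y, (forall m, m < M -> y m = x m) ->
     f y n = f x n) -> continuous f.
Proof.
move=> fP x; apply/cvg_sup => n.
move: x; apply/(@continuousP _ (initial_topology (@^~ n))) => _ [B _ <-].
rewrite openE => x /= Bx; have [M fM] := fP x n.
by apply: filterS (cylinder_nbhs x M) => y /fM fyn; rewrite /preimage /= fyn.
Qed.

Fixpoint words n : seq (seq bool) :=
  if n is m.+1 then [seq b :: w | b <- [:: true; false], w <- words m]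
  else [:: [::]].

(* The bricks X_w, w in S, partition the Cantor set; n bounds the lengths of the
   words in S, which turns the covering condition into a finite one. *)
Definition prefix_code n S :=
  all (fun w => has (fun v => prefix v w) S) (words n) &&
  pairwise (fun v w => ~~ (prefix v w || prefix w v)) S.

Lemma mkseq_words x n : mkseq x n \in words n.
Proof.
elim: n x => // n IHn x.
have -> : mkseq x n.+1 = x 0 :: mkseq (x \o S) n.
  by rewrite /mkseq /= (iotaDl 1 0) -map_comp.
by apply: (allpairs_f cons _ (IHn _)); case: (x 0).
Qed.

Definition drop_bits n x : cantor_space := fun m => x (n + m).

Lemma prepend_drop_bits w x : prefix w (mkseq x (size w)) ->
  prepend w (drop_bits (size w) x) = x.
Proof.
rewrite prefixE take_oversize ?size_mkseq// => /eqP E.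
apply/funext => n; rewrite /prepend /drop_bits.
by case: ltnP => wn; [rewrite -E nth_mkseq|rewrite subnKC].
Qed.

Lemma mkseq_prepend w x : mkseq (prepend w x) (size w) = w.
Proof.
apply: (@eq_from_nth _ false); rewrite size_mkseq// => i iw.
by rewrite nth_mkseq// /prepend iw.
Qed.

Lemma drop_bits_prepend w x : drop_bits (size w) (prepend w x) = x.
Proof.
apply: (@prepend_inj w); apply: prepend_drop_bits.
by rewrite mkseq_prepend prefix_refl.
Qed.

Section Code.
Variables (N : nat) (S : seq (seq bool)).
Hypothesis codeS : prefix_code N S.

Definition code_index x := find (fun w => w == mkseq x (size w)) S.

(** The first [N] bits of [x] form a word of length [N], and the covering condition provides an
    element of [S] that begins it. *)
Lemma code_index_lt x : code_index x < size S.
Proof.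
have /andP[/allP cover _] := codeS.
have /hasP[w wS wx] := cover _ (mkseq_words x N); rewrite -has_find.
apply/hasP; exists w => //; move: wx.
rewrite prefixE => /eqP E; rewrite -[in X in X == _]E.
rewrite /mkseq -map_take take_iota (minn_idPl _)// -E size_take size_mkseq.
by rewrite geq_min leqnn orbT.
Qed.

Lemma prepend_code_index x : let w := nth [::] S (code_index x) in
  prepend w (drop_bits (size w) x) = x.
Proof.
move=> w; apply: prepend_drop_bits.
have := code_index_lt x; rewrite -has_find => /(nth_find [::]) /eqP E.
by rewrite [X in prefix X _]E prefix_refl.
Qed.

Lemma code_uniq i j x y : i < size S -> j < size S ->
  prepend (nth [::] S i) x = prepend (nth [::] S j) y -> i = j.
Proof.
have /andP[_ /(pairwiseP [::]) pw] := codeS.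
move=> iS jS xy; have := prepend_prefix xy.
have [ij|ji|//] := ltngtP i j; first by rewrite (negbTE (pw i j iS jS ij)).
by rewrite orbC (negbTE (pw j i jS iS ji)).
Qed.

Lemma code_indexE i x : i < size S -> code_index (prepend (nth [::] S i) x) = i.
Proof.
move=> iS; apply: code_uniq (code_index_lt _) iS _.
exact: prepend_code_index.
Qed.

Lemma code_partition :
  partition [set: 'I_(size S)] (brick \o (fun i : 'I_(size S) => nth [::] S i))
    [set: cantor_space].
Proof.
split=> [|i j _ _ [x [[y _ yx] [z _ zx]]]|i _]; last by eexists; exists point.
  rewrite -subTset => x _; exists (Ordinal (code_index_lt x)) => //.
  by eexists; last exact: prepend_code_index.
apply: val_inj; exact: code_uniq (ltn_ord i) (ltn_ord j) (etrans yx (esym zx)).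
Qed.

End Code.

(** Prefix replacement: for codes of equal size this is the element of V described by the table from
    [S] to [T]. *)
Definition code_map S T x : cantor_space :=
  let i := code_index S x in
  prepend (nth [::] T i) (drop_bits (size (nth [::] S i)) x).

Lemma code_mapE N S T i x : prefix_code N S -> i < size S ->
  code_map S T (prepend (nth [::] S i) x) = prepend (nth [::] T i) x.
Proof.
by move=> codeS iS; rewrite /code_map (code_indexE codeS)// drop_bits_prepend.
Qed.

Lemma code_mapK N M S T : prefix_code N S -> prefix_code M T ->
  size S = size T -> cancel (code_map S T) (code_map T S).
Proof.
move=> codeS codeT ST x; have xE := prepend_code_index codeS x.
have iS := code_index_lt codeS x.
by rewrite -[in LHS]xE (code_mapE _ _ codeS)// (code_mapE _ _ codeT) -?ST.
Qed.

Lemma code_map_continuous N S T : prefix_code N S -> continuous (code_map S T).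
Proof.
move=> codeS; apply: cantor_continuous => x n.
set i := code_index S x; pose w := nth [::] S i.
(* The first [size w] bits determine the branch; the output bit [n] then comes from the new prefix
   or from an input position at most [size w + n]. *)
exists (size w + n.+1) => y yx; have iS : i < size S := code_index_lt codeS x.
have yE : prepend w (drop_bits (size w) y) = y.
  apply: prepend_drop_bits.
  have -> : mkseq y (size w) = mkseq x (size w).
    apply/eq_in_map => m; rewrite mem_iota => /andP[_ mw].
    by apply: yx; rewrite ltn_addr.
  by rewrite -[in mkseq x _](prepend_code_index codeS x) mkseq_prepend
    prefix_refl.
rewrite -[in LHS]yE (code_mapE _ _ codeS)//.
rewrite /code_map -/i -/w /prepend /drop_bits.
case: ltnP => // tn; apply: yx.
by rewrite ltn_add2l ltnS leq_subr.
Qed.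

Section CodeHomeo.
Variables (N M : nat) (S T : seq (seq bool)).
Hypotheses (codeS : prefix_code N S) (codeT : prefix_code M T)
  (ST : size S = size T).

Definition code_homeo : homeo cantor_space :=
  Homeo (code_mapK codeS codeT ST) (code_mapK codeT codeS (esym ST))
    (code_map_continuous codeS) (code_map_continuous codeT).

Lemma code_homeoE i x : i < size S ->
  code_homeo (prepend (nth [::] S i) x) = prepend (nth [::] T i) x.
Proof. exact: (code_mapE _ _ codeS). Qed.

Lemma code_thompsonV : code_homeo \in subgroup_set thompsonV.
Proof.
apply/mem_set; exists 'I_(size S), (fun i : 'I_(size S) => nth [::] S i),
  (fun i : 'I_(size S) => nth [::] T i); split.
- exact: code_partition codeS.
- rewrite ST; exact: code_partition codeT.
- by move=> i x; exact: code_homeoE.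
Qed.

Definition code_elt : thompsonV :=
  exist (fun f => f \in subgroup_set thompsonV) _ code_thompsonV.

Lemma code_eltE i x : i < size S ->
  \val code_elt (prepend (nth [::] S i) x) = prepend (nth [::] T i) x.
Proof. exact: code_homeoE. Qed.

End CodeHomeo.

End PrefixCode.

Lemma displaced_pair_thompsonV : displaced_pair thompsonV.
Proof.
(* x swaps X_010 with X_011 and y swaps X_0100 with X_0101, while the positive
   powers of t map X_01 into X_1. *)
pose St := [:: [:: false; false]; [:: false; true]; [:: true]].
pose Tt := [:: [:: false]; [:: true; false]; [:: true; true]].
pose Sx := [:: [:: false; true; false]; [:: false; true; true];
  [:: false; false]; [:: true]].
pose Tx := [:: [:: false; true; true]; [:: false; true; false];
  [:: false; false]; [:: true]].
pose Sy := [:: [:: false; true; false; false]; [:: false; true; false; true];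
  [:: false; true; true]; [:: false; false]; [:: true]].
pose Ty := [:: [:: false; true; false; true]; [:: false; true; false; false];
  [:: false; true; true]; [:: false; false]; [:: true]].
(* The numbers are the maximal word lengths; the code conditions hold by evaluation. *)
pose t := @code_elt 2 2 St Tt isT isT erefl.
pose x := @code_elt 3 3 Sx Tx isT isT erefl.
pose y := @code_elt 4 4 Sy Ty isT isT erefl.
have tE := @code_eltE 2 2 St Tt isT isT erefl; rewrite -/t in tE.
have xE := @code_eltE 3 3 Sx Tx isT isT erefl; rewrite -/x in xE.
have yE := @code_eltE 4 4 Sy Ty isT isT erefl; rewrite -/y in yE.
have comE (f g : thompsonV) p : \val (f * g)%g p = \val f (\val g p) by [].
have bitsE (p : cantor_space) : p = prepend [:: p 0%N; p 1%N] (drop_bits 2 p).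
  exact/esym/(@prepend_drop_bits [:: p 0%N; p 1%N])/prefix_refl.
have bitE (p : cantor_space) : p = prepend [:: p 0%N] (drop_bits 1 p).
  exact/esym/(@prepend_drop_bits [:: p 0%N])/prefix_refl.
(* This is the complement of X_01, which contains both supports. *)
pose out (p : cantor_space) := p 0%N || ~~ p 1%N.
have outP p : out p -> p 0%N = true \/ p 0%N = false /\ p 1%N = false.
  by rewrite /out; case: (p 0%N); case: (p 1%N); auto.
have xout p : out p -> \val x p = p.
  move=> /outP[p0|[p0 p1]]; first by rewrite (bitE p) p0 (xE 3%N).
  by rewrite (bitsE p) p0 p1 (xE 2%N).
have yout p : out p -> \val y p = p.
  move=> /outP[p0|[p0 p1]]; first by rewrite (bitE p) p0 (yE 4%N).
  by rewrite (bitsE p) p0 p1 (yE 3%N).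
(* [t] maps X_01 onto X_10 and X_1 onto X_11, so X_1 absorbs the orbits. *)
have t1 p : p 0%N || p 1%N -> \val t p 0%N.
  case p0: (p 0%N) => p1; first by rewrite (bitE p) p0 (tE 2%N).
  by rewrite (bitsE p) p0 (p1 : p 1%N = true) (tE 1%N).
have tm m p : ~~ out p -> \val (t ^+ m.+1)%g p 0%N.
  rewrite negb_or negbK => /andP[_ p1].
  elim: m => [|m IHm]; first by rewrite expg1 t1 ?p1 ?orbT.
  by rewrite expgS comE t1 ?IHm.
exists x, y, (fun n => (t ^+ n)%g); split=> [|i j ij].
  (* [x y] sends this point of X_0100 into X_0111, while [y x] sends it into X_0110; the fourth bits
     differ. *)
  pose q := prepend [:: false; true; false; false] point.
  have cat3 a b z : prepend [:: false; true; a; b] z =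
    prepend [:: false; true; a] (prepend [:: b] z).
    exact: (prepend_cat [:: _; _; _]).
  have yq : \val y q = prepend [:: false; true; false; true] point.
    exact: (yE 0%N).
  have xq : \val x q =
      prepend [:: false; true; true] (prepend [:: false] point).
    by rewrite /q cat3; exact: (xE 0%N).
  have xyq : \val x (\val y q) =
      prepend [:: false; true; true] (prepend [:: true] point).
    by rewrite yq cat3; exact: (xE 0%N).
  have yxq : \val y (\val x q) = \val x q by rewrite xq; exact: (yE 2%N).
  move=> /(congr1 (fun f : thompsonV => \val f q 3%N)); rewrite !comE.
  by rewrite xyq yxq xq.
have -> : (t ^+ i)^-1 * t ^+ j = t ^+ (j - i.+1).+1.
  by rewrite -{1}(subnKC ij) addSnnS expgnDr mulKg.
apply/val_inj/homeo_commute => p.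
have [pout|pin] := boolP (out p); first by right; exact: yout.
left; have fix_conj (f g : thompsonV) : \val f (\val g p) = \val g p ->
    \val (f ^ g)%g p = p.
  move=> fgp; have -> : \val (f ^ g)%g p =
    homeo_inv (\val g) (\val f (\val g p)) by [].
  by rewrite fgp homeoK.
by apply: fix_conj; apply: xout; rewrite /out tm.
Qed.

Theorem corollary7p6 (R : realType) (U : set (normed_unitary R)) :
  [/\ ~ uniformly_approximable U (thompsonF R),
      ~ uniformly_approximable U (derived (thompsonF R)),
      ~ uniformly_approximable U (thompsonT R) &
      ~ uniformly_approximable U thompsonV] /\
  (forall Gamma Lambda : groupType,
     countable [set: Gamma] -> countable [set: Lambda] ->
     infinite_set [set: Lambda] -> amenable R Lambda ->
     ~ (forall x y : Gamma, commute x y) ->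
     ~ uniformly_approximable U (wreath Gamma Lambda)).
Proof.
(* The pair in F' serves F through the inclusion, and then T through periodization. *)
have F'pair := @displaced_pair_thompsonF' R.
have Fpair : displaced_pair (thompsonF R).
  exact: (@displaced_pair_morph _ _ (fun f => \val f) _ val_inj F'pair).
split.
  split; apply: displaced_pair_not_approximable => //.
  - exact: displaced_pair_thompsonT.
  - exact: displaced_pair_thompsonV.
move=> Gamma Lambda _ _ Linf _ nab.
exact/displaced_pair_not_approximable/displaced_pair_wreath.
Qed.
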